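(* Let $p$ be a prime. As $R$ ranges over all indecomposable (finite, associative, with $1\ne0$) rings of order $p^4$, there are, up to graph isomorphism, exactly five distant graphs $G(R,\Delta)$. With $J$ denoting the Jacobson radical of $R$, these are: (1) the complete graph with $p^4+1$ vertices; (2) the distant graph of the projective line over a local ring $R$ (of order $p^4$) with $|J|=p^2$; (3) the distant graph of the projective line over a local ring $R$ (of order $p^4$) with $|J|=p^3$; (4) the distant graph $G(R,\Delta)$ in the case $R/J\cong F(p)\times F(p)$, whose vertex set is the union of $p^3+p^2$ pairwise vertex-disjoint maximal cliques, with $\omega\bigl(G(R,\Delta)\bigr)=p+1$; (5) the distant graph $G(M_2(p),\Delta)$.
   Context: All rings are finite, associative, with $1\ne 0$. A ring is indecomposable if it is not isomorphic to a direct product of two nonzero rings. A pair $(a,b)\in R^2$ is admissible if it is the first row of some matrix in $GL_2(R)$. The projective line $\mathbb{P}(R)$ is the set of left cyclic submodules $R(a,b)=\{(\alpha a,\alpha b):\alpha\in R\}$ of the free left module $R^2$ generated by admissible pairs $(a,b)$; equivalently, it is the orbit of $R(1,0)$ under the right action of $GL_2(R)$. Two points $R(a,b),R(c,d)\in\mathbb{P}(R)$ are distant, written $R(a,b)\,\Delta\, R(c,d)$, if $\begin{pmatrix} a&b\\ c&d\end{pmatrix}\in GL_2(R)$ (this does not depend on the choice of admissible generators). The distant graph $G(R,\Delta)$ is the undirected simple graph with vertex set $\mathbb{P}(R)$ in which two vertices are joined by an edge if and only if they are distant. $F(q)$ denotes the finite field with $q$ elements and $M_n(q)$ the ring of $n\times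 n$ matrices over $F(q)$. Local rings need not be commutative. A clique is a set of pairwise adjacent vertices. Convention: maximal cliques are taken to be maximum cliques, i.e. ''maximal clique'' of a graph $G$ means a clique with the largest possible number of vertices, and this number is denoted by $\omega(G)$. *)

(* Defs.v *)
From HB Require Import structures.
From mathcomp Require Import all_boot all_order all_algebra.
Set Implicit Arguments.
Unset Strict Implicit.
Unset Printing Implicit Defensive.
Import GRing.Theory.
Local Open Scope ring_scope.
Local Open Scope quotient_scope.

(** * Finite simple graphs *)

Record sgraph := SGraph {
  vertex :> finType;
  adj : rel vertex;
  adj_sym : symmetric adj;
  adj_irrefl : irreflexive adj
}.

Definition graph_iso (G H : sgraph) : Prop :=
  exists2 f : G -> H, bijective f & {mono f : x y / adj x y}.

Definition complete_graph (G : sgraph) : Prop :=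
  forall x y : G, adj x y = (x != y).

Definition clique (G : sgraph) (S : {set G}) : bool :=
  [forall x in S, forall y in S, (x != y) ==> adj x y].

Definition clique_number (G : sgraph) : nat :=
  \max_(S : {set G} | clique S) #|S|.

(* "Maximal" refers to cardinality, not to inclusion. *)
Definition maximal_clique (G : sgraph) (S : {set G}) : bool :=
  clique S && (#|S| == clique_number G).

Definition union_of_disjoint_maximal_cliques (G : sgraph) (n : nat) : Prop :=
  exists P : {set {set G}},
    [/\ cover P = [set: G], trivIset P, #|P| = n
      & forall S, S \in P -> maximal_clique S].

(** * The distant graph of the projective line over a finite ring *)

Section ProjectiveLine.

Variable R : finNzRingType.

(* [unitmx] is not available: it is restricted to commutative rings. *)
Definition GL2 (A : 'M[R]_2) : bool :=
  [exists B : 'M[R]_2, (A *m B == 1%:M) && (B *m A == 1%:M)].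

Definition admissible (v : 'rV[R]_2) : bool :=
  [exists A : 'M[R]_2, GL2 A && (row 0 A == v)].

(* [*:] multiplies by scalars on the left. *)
Definition left_cyclic (v : 'rV[R]_2) : {set 'rV[R]_2} :=
  [set a *: v | a : R].

Definition projective_line : {set {set 'rV[R]_2}} :=
  [set left_cyclic v | v in admissible].

Definition point : finType := {P : {set 'rV[R]_2} | P \in projective_line}.

(* Since the invertibility of the matrix does not depend on the admissible
   generators, it is only required for some choice of them. *)
Definition distant (P Q : point) : bool :=
  [exists u : 'rV[R]_2, exists v : 'rV[R]_2,
    [&& admissible u, admissible v, val P == left_cyclic u,
        val Q == left_cyclic v & GL2 (col_mx u v)]].

Lemma GL2_col_mxC (u v : 'rV[R]_2) : GL2 (col_mx u v) -> GL2 (col_mx v u).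
Proof.
move=> /existsP[B /andP[/eqP AB /eqP BA]].
pose S : 'M[R]_(1 + 1) := block_mx 0 1%:M 1%:M 0.
have SS : S *m S = 1%:M.
  by rewrite mulmx_block !mulmx0 !mul0mx !mulmx1 !addr0 !add0r -scalar_mx_block.
have SA : S *m col_mx u v = col_mx v u.
  by rewrite mul_block_col !mul0mx !mul1mx addr0 add0r.
apply/existsP; exists (B *m S); apply/andP; split; apply/eqP.
  by rewrite -SA -!mulmxA (mulmxA (col_mx u v)) AB mul1mx.
by rewrite -SA -mulmxA (mulmxA S S) SS mul1mx.
Qed.

Lemma distant_sym : symmetric distant.
Proof.
suff h P Q : distant P Q -> distant Q P by move=> P Q; apply/idP/idP; apply: h.
move=> /existsP[u /existsP[v /and5P[au av Pu Qv uv]]].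
apply/existsP; exists v; apply/existsP; exists u.
by apply/and5P; split=> //; apply: GL2_col_mxC.
Qed.

Lemma distant_irrefl : irreflexive distant.
Proof.
move=> P; apply/negbTE/negP.
move=> /existsP[u /existsP[v /and5P[_ _ /eqP Pu /eqP Pv]]].
move=> /existsP[B /andP[/eqP AB _]].
have : v \in left_cyclic u.
  by rewrite -Pu Pv; apply/imsetP; exists 1; rewrite ?scale1r.
move=> /imsetP[a _ va].
pose w : 'rV[R]_(1 + 1) := row_mx (- a)%:M 1%:M.
have w0 : w = 0.
  rewrite -[w]mulmx1 -AB mulmxA mul_row_col mul_scalar_mx mul1mx va.
  by rewrite scaleNr addNr mul0mx.
have := congr1 rsubmx w0; rewrite row_mxKr => /matrixP/(_ 0 0)/eqP.
by rewrite !mxE eqxx oner_eq0.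
Qed.

Definition distant_graph : sgraph := SGraph distant_sym distant_irrefl.

End ProjectiveLine.

(** * Finite rings *)

Definition ring_iso (R S : nzRingType) : Prop :=
  exists f : {rmorphism R -> S}, bijective f.

Definition indecomposable (R : finNzRingType) : Prop :=
  ~ exists R1 R2 : finNzRingType, ring_iso R (R1 * R2)%type.

Section JacobsonRadical.

Variable R : finNzRingType.

(* A left ideal is proper iff it does not contain 1. *)
Definition proper_left_ideal (I : {set R}) : bool :=
  [&& 0 \in I, 1 \notin I
    & [forall a, forall u in I, forall v in I, a * u + v \in I]].

Definition maximal_left_ideal (I : {set R}) : bool :=
  maxset proper_left_ideal I.

Definition jacobson : {set R} := \bigcap_(I | maximal_left_ideal I) I.

Definition local_ring : Prop := exists! I : {set R}, maximal_left_ideal I.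

Lemma proper_left_idealP (I : {set R}) :
  reflect (idealr_closed I) (proper_left_ideal I).
Proof.
apply: (iffP and3P) => -[I0 I1 IM]; split=> //.
  by move=> a u v uI vI; move: IM => /forallP/(_ a)/forall_inP/(_ u uI)/forall_inP; apply.
by apply/forallP=> a; apply/forall_inP=> u uI; apply/forall_inP=> v; apply: IM.
Qed.

Lemma jacobson_idealr_closed : idealr_closed (jacobson : {pred R}).
Proof.
have max_closed I : maximal_left_ideal I -> idealr_closed I.
  by move=> /maxsetp/proper_left_idealP.
split.
- by apply/bigcapP=> I /max_closed[].
- have id0 : proper_left_ideal [set 0].
    apply/proper_left_idealP; split; rewrite ?inE ?oner_eq0 //.
    by move=> a u v /set1P-> /set1P->; rewrite mulr0 addr0 inE.
  have [M maxM _] := maxset_exists id0.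
  apply/negP=> /bigcapP/(_ M maxM); apply/negP.
  by have [] := max_closed M maxM.
- move=> a u v /bigcapP uJ /bigcapP vJ; apply/bigcapP=> I maxI.
  by have [_ _] := max_closed I maxI; apply; [apply: uJ | apply: vJ].
Qed.

Lemma jacobsonMr r x : x \in jacobson -> x * r \in jacobson.
Proof.
move=> /bigcapP xJ; apply/bigcapP=> M maxM.
have [M0 M1 MM] := proper_left_idealP _ (maxsetp maxM).
have [rM | rM] := boolP (r \in M); first by rewrite -[_ * r]addr0 MM.
pose K := [set y | y * r \in M].
have idK : proper_left_ideal K.
  apply/proper_left_idealP; split; rewrite ?inE ?mul0r ?mul1r //.
  by move=> a u v; rewrite !inE mulrDl -mulrA; apply: MM.
suff maxK : maximal_left_ideal K by have := xJ K maxK; rewrite inE.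
apply/maxsetP; split=> // N /proper_left_idealP[N0 N1 NN] KN.
apply/eqP; rewrite eqEsubset KN andbT; apply/subsetP=> n nN; rewrite inE.
apply/negPn/negP=> nrM.
pose L := [set a * (n * r) + m | a in [set: R], m in M].
have ML : M \subset L.
  by apply/subsetP=> m mM; apply/imset2P; exists 0 m; rewrite ?inE ?mul0r ?add0r.
have nrL : n * r \in L.
  by apply/imset2P; exists 1 0; rewrite ?inE ?mul1r ?addr0.
have L1 : 1 \in L.
  apply/negPn/negP=> L1; move: nrM; apply/negP/negPn.
  rewrite -(maxsetsup maxM _ ML) //; apply/proper_left_idealP; split=> //.
    exact: (subsetP ML).
  move=> a _ _ /imset2P[b m _ mM ->] /imset2P[c k _ kM ->].
  apply/imset2P; exists (a * b + c) (a * m + k); rewrite ?inE ?MM //.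
  by rewrite mulrDl mulrDr !mulrA addrACA.
have [s m _ mM def1] := imset2P L1.
have : 1 - r * s * n \in K.
  have rm : r - r * s * n * r = r * m.
    by rewrite -{1}[r]mulr1 def1 mulrDr !mulrA addrAC subrr add0r.
  by rewrite inE mulrBl mul1r rm -[r * m]addr0 MM.
move=> /(subsetP KN) n1; move: N1; apply/negP/negPn.
by rewrite -[1](subrK (r * s * n)) addrC NN.
Qed.

Definition jacobson_pred : {pred R} := fun x => x \in jacobson.

HB.instance Definition _ := isIdealr.Build R jacobson_pred jacobson_idealr_closed.

(* [ring_quotient] only equips quotients of commutative rings with a ring
   structure, but the quotient by the radical makes sense in general. *)
Definition quot_jacobson := Quotient.quot jacobson_pred.

HB.instance Definition _ :=
  GRing.Zmodule.copy quot_jacobson (Quotient.quot jacobson_pred).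

Definition quot_one : quot_jacobson := \pi_quot_jacobson 1.

Definition quot_mul (x y : quot_jacobson) : quot_jacobson :=
  \pi_quot_jacobson (repr x * repr y).

Lemma pi_quot_eq (x y : R) :
  (\pi_quot_jacobson x == \pi_quot_jacobson y) = (x - y \in jacobson).
Proof. exact/esym/(@Quotient.idealrBE R jacobson_pred). Qed.

Lemma pi_quot_mul (x y : R) :
  \pi_quot_jacobson (x * y) = quot_mul (\pi x) (\pi y).
Proof.
set x' := repr (\pi_quot_jacobson x); set y' := repr (\pi_quot_jacobson y).
have xx' : x - x' \in jacobson by rewrite -pi_quot_eq reprK.
have yy' : y - y' \in jacobson by rewrite -pi_quot_eq reprK.
apply/eqP; rewrite /quot_mul pi_quot_eq -/x' -/y'.
have -> : x * y - x' * y' = x' * (y - y') + (x - x') * y.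
  by rewrite mulrBr mulrBl [RHS]addrC addrA subrK.
by have [_ _] := jacobson_idealr_closed; apply; rewrite ?jacobsonMr.
Qed.

Lemma pi_quot_add (x y : R) :
  \pi_quot_jacobson (x + y) = \pi_quot_jacobson x + \pi_quot_jacobson y.
Proof. exact: (@Quotient.pi_add R jacobson_pred). Qed.

Fact quot_mulA : associative quot_mul.
Proof.
move=> x y z; rewrite -[x]reprK -[y]reprK -[z]reprK.
by rewrite -(pi_quot_mul _ (repr z)) -(pi_quot_mul _ (repr y)) -!pi_quot_mul mulrA.
Qed.

Fact quot_mul1l : left_id quot_one quot_mul.
Proof. by move=> x; rewrite -[x]reprK -pi_quot_mul mul1r. Qed.

Fact quot_mul1r : right_id quot_one quot_mul.
Proof. by move=> x; rewrite -[x]reprK -pi_quot_mul mulr1. Qed.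

Fact quot_mulDl : left_distributive quot_mul +%R.
Proof.
move=> x y z; rewrite -[x]reprK -[y]reprK -[z]reprK.
by rewrite -pi_quot_add -!pi_quot_mul -pi_quot_add mulrDl.
Qed.

Fact quot_mulDr : right_distributive quot_mul +%R.
Proof.
move=> x y z; rewrite -[x]reprK -[y]reprK -[z]reprK.
by rewrite -pi_quot_add -!pi_quot_mul -pi_quot_add mulrDr.
Qed.

Fact quot_one_neq0 : quot_one != 0.
Proof.
have -> : (0 : quot_jacobson) = \pi_quot_jacobson 0.
  by apply: (addrI (\pi_quot_jacobson 0)); rewrite -pi_quot_add !addr0.
rewrite /quot_one pi_quot_eq subr0.
by have [_ ->] := jacobson_idealr_closed.
Qed.

HB.instance Definition _ := GRing.Zmodule_isNzRing.Build quot_jacobson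
  quot_mulA quot_mul1l quot_mul1r quot_mulDl quot_mulDr quot_one_neq0.

End JacobsonRadical.

(* All rings satisfying [C] have the same distant graph up to isomorphism,
   namely [G], and there is at least one such ring. *)
Definition is_the_distant_graph (C : finNzRingType -> Prop) (G : sgraph) : Prop :=
  (exists R : finNzRingType, C R) /\
  (forall R : finNzRingType, C R -> graph_iso (distant_graph R) G).

(* Main.v *)
From HB Require Import structures.
Require Import Defs.
From mathcomp Require Import all_boot all_order all_algebra all_field.
Set Implicit Arguments.
Unset Strict Implicit.
Unset Printing Implicit Defensive.
Import GRing.Theory.
Local Open Scope ring_scope.
Local Open Scope quotient_scope.

(** Everything rests on one observation: a 2 x 2 matrix over a finite ring R is
    invertible as soon as its image modulo the Jacobson radical J is. Hence G(R)
    is the graph G(R/J) in which every vertex is replaced by |J| pairwise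
    nonadjacent copies with the same neighbours ([radical_map_iso]); it is
    determined by R/J and |J|. If R is local, R/J is a division ring with q
    elements, and G(R/J) is the complete graph on its q + 1 points
    ([division_iso]). If R/J = F_p x F_p, then G(R/J) is the tensor product of
    two complete graphs on p + 1 vertices ([product_iso]), and the graph is
    partitioned by the diagonals {((i, i + c), k) : i}, which are cliques of the
    largest possible size, since the vertices of a clique differ in i.

    It remains to find R/J when R is indecomposable of order p^4
    ([indecomposable_cases]). A ring whose only idempotents are 0 and 1 is local.
    Otherwise let e be a nontrivial idempotent. Elements of e R (1 - e) or
    (1 - e) R e outside J yield a system of 2 x 2 matrix units
    ([matrix_unit_pair]), hence an embedding of M_2(p), which already has p^4
    elements, into R/J, an algebra over F_p. So
    - if J = 0, then e is not central and R is M_2(p);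
    - if |J| = p, then R/J is too small for matrix units, and an idempotent that
      annihilates J on both sides is central, contradicting indecomposability; the
      annihilator of J is large enough to contain one ([no_jacobson_p]);
    - if |J| = p^2, then e and 1 - e span R/J, which is F_p x F_p;
    - if |J| = p^3, then there is no room for e and 1 - e in R/J.
    In a local ring |J| = p is excluded in the same way, and |J| = 1, p^2, p^3
    are left.

    The first four graphs have different numbers of vertices. G(M_2(p)) is not
    complete, and no two of its vertices have the same neighbours
    ([matrix_twin_free]), which distinguishes it from the three graphs obtained by
    copying vertices. Finite fields, trivial extensions of rings by bimodules and
    M_2(p) provide a ring for each graph. *)

(** * Finite graphs *)

Lemma graph_iso_refl (G : sgraph) : graph_iso G G.
Proof. by exists id => //; exists id. Qed.

Lemma graph_iso_sym (G H : sgraph) : graph_iso G H -> graph_iso H G.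
Proof.
move=> [f [g fK gK] fadj]; exists g; first by exists f.
by move=> x y; rewrite -fadj !gK.
Qed.

Lemma graph_iso_trans (G H K : sgraph) :
  graph_iso G H -> graph_iso H K -> graph_iso G K.
Proof.
move=> [f fbij fadj] [g gbij gadj]; exists (g \o f); first exact: bij_comp.
by move=> x y /=; rewrite gadj fadj.
Qed.

Lemma graph_iso_card (G H : sgraph) : graph_iso G H -> #|G| = #|H|.
Proof. by move=> [f fbij _]; apply: bij_eq_card fbij. Qed.

Lemma graph_iso_complete (G H : sgraph) :
  graph_iso G H -> complete_graph G -> complete_graph H.
Proof.
move=> /graph_iso_sym[f fbij fadj] Gc x y.
by rewrite -fadj Gc (inj_eq (bij_inj fbij)).
Qed.

Definition twin_free (G : sgraph) : Prop :=
  forall x y : G, (forall z, adj x z = adj y z) -> x = y.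

Lemma graph_iso_twin_free (G H : sgraph) :
  graph_iso G H -> twin_free G -> twin_free H.
Proof.
move=> /graph_iso_sym[f [g fK gK] fadj] Gt x y xy; apply: (can_inj fK).
by apply: Gt => z; rewrite -[z]gK !fadj xy.
Qed.

Section CompleteGraph.
Variable n : nat.

Definition complete_adj (x y : 'I_n) := x != y.
Fact complete_sym : symmetric complete_adj.
Proof. by move=> x y; rewrite /complete_adj eq_sym. Qed.
Fact complete_irrefl : irreflexive complete_adj.
Proof. by move=> x; rewrite /complete_adj eqxx. Qed.
Definition complete := SGraph complete_sym complete_irrefl.

Lemma complete_iso (G : sgraph) :
  complete_graph G -> #|G| = n -> graph_iso G complete.
Proof.
move=> Gc cardG; exists (fun x => cast_ord cardG (enum_rank x)).
  by apply: inj_card_bij (inj_comp (@cast_ord_inj _ _ _) enum_rank_inj) _;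
     rewrite card_ord cardG.
move=> x y; rewrite Gc /= /complete_adj.
by rewrite (inj_eq (@cast_ord_inj _ _ _)) (inj_eq enum_rank_inj).
Qed.

End CompleteGraph.

Section Blowup.
Variables (G : sgraph) (m : nat).

Definition blowup_adj (x y : G * 'I_m) := adj x.1 y.1.
Fact blowup_sym : symmetric blowup_adj.
Proof. by move=> x y; apply: adj_sym. Qed.
Fact blowup_irrefl : irreflexive blowup_adj.
Proof. by move=> x; apply: adj_irrefl. Qed.
Definition blowup := SGraph blowup_sym blowup_irrefl.

Lemma blowup_twins : (0 < #|G|)%N -> (1 < m)%N -> ~ twin_free blowup.
Proof.
case/card_gt0P=> x _ m1 tw.
have /(_ (fun=> erefl)) := tw (x, Ordinal (ltnW m1)) (x, Ordinal m1).
by case.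
Qed.

(** Numbering the vertices of each fibre, in any way, identifies H with the
    blow-up. *)
Lemma blowup_fibres (H : sgraph) (f : H -> G) :
    {mono f : x y / adj x y} -> (forall y, #|[set x | f x == y]| = m) ->
  graph_iso H blowup.
Proof.
move=> fadj fm; pose F x := [set z | f z == f x].
have xF x : x \in F x by rewrite inE.
pose h x : G * 'I_m := (f x, cast_ord (fm (f x)) (enum_rank_in (xF x) x)).
exists h => [|x y]; last exact: fadj.
have h_inj : injective h.
  move=> x y [fxy] /= /(congr1 (nth x (enum (F y)))).
  have eF : enum (F y) = enum (F x) by rewrite /F fxy.
  by rewrite (nth_enum_rank_in x (xF y)) // eF (nth_enum_rank_in x (xF x)).
apply: inj_card_bij h_inj _; rewrite card_prod card_ord mulnC.
rewrite -[#|H|]sum1_card (partition_big f predT) //= -[#|G|]sum1_card big_distrr /=.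
apply/eq_leq/eq_bigr => y _; rewrite muln1 -(fm y) -sum1_card.
by apply: eq_bigl => x; rewrite inE.
Qed.

End Blowup.

Lemma blowup_iso (G H : sgraph) (m : nat) :
  graph_iso G H -> graph_iso (blowup G m) (blowup H m).
Proof.
move=> [f [g fK gK] fadj]; exists (fun x => (f x.1, x.2)) => [|x y]; last exact: fadj.
by exists (fun x => (g x.1, x.2)) => -[x i] /=; rewrite ?fK ?gK.
Qed.

Lemma blowup1 (G : sgraph) : graph_iso (blowup G 1) G.
Proof.
exists fst => [|x y] //; exists (fun x => (x, ord0)) => // -[x i] /=.
by rewrite (ord1 i).
Qed.

Section Tensor.
Variables G H : sgraph.

Definition tensor_adj (x y : G * H) := adj x.1 y.1 && adj x.2 y.2.
Fact tensor_sym : symmetric tensor_adj.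
Proof. by move=> x y; congr (_ && _); apply: adj_sym. Qed.
Fact tensor_irrefl : irreflexive tensor_adj.
Proof. by move=> x; rewrite /tensor_adj adj_irrefl. Qed.
Definition tensor := SGraph tensor_sym tensor_irrefl.

End Tensor.

Lemma tensor_iso (G G' H H' : sgraph) :
  graph_iso G G' -> graph_iso H H' -> graph_iso (tensor G H) (tensor G' H').
Proof.
move=> [f [f' fK f'K] fadj] [g [g' gK g'K] gadj].
exists (fun x => (f x.1, g x.2)) => [|x y]; last by rewrite /= /tensor_adj /= fadj gadj.
by exists (fun x => (f' x.1, g' x.2)) => -[x y] /=; rewrite ?fK ?gK ?f'K ?g'K.
Qed.

(** * Cliques of a blown-up product of two complete graphs *)

Section Rook.
Variables n m : nat.
Let G := blowup (tensor (complete n.+1) (complete n.+1)) m.+1.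

(** The vertices of a clique have distinct first coordinates. *)
Lemma rook_clique_le (S : {set G}) : clique S -> (#|S| <= n.+1)%N.
Proof.
move=> Sc; rewrite -[n.+1]card_ord.
rewrite -(card_in_imset (f := fun x : G => x.1.1)) ?max_card // => x y xS yS exy.
apply/eqP/negPn/negP => nxy.
have := forall_inP (forall_inP Sc x xS) y yS.
by rewrite nxy /= /blowup_adj /= /tensor_adj /= /complete_adj exy eqxx.
Qed.

Definition diagonal (x : G) := (x.1.2 - x.1.1, x.2).

(** The vertices ((i, i + c.1), c.2), with addition modulo n + 1, differ in both
    coordinates; there is one of them for each i. *)
Lemma diagonalP (c : 'I_n.+1 * 'I_m.+1) :
  clique (diagonal @^-1: [set c]) /\ #|diagonal @^-1: [set c]| = n.+1.
Proof.
pose F i : G := ((i, i + c.1), c.2).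
have -> : diagonal @^-1: [set c] = F @: setT.
  apply/setP=> -[[i j] k]; rewrite !inE; apply/eqP/imsetP=> [ec|[i' _ [-> -> ->]]].
    by exists i; rewrite // /F -ec /= addrC subrK.
  by rewrite /diagonal /= addrC addKr -surjective_pairing.
have Finj : injective F by move=> i j [].
split; last by rewrite card_imset // cardsT card_ord.
apply/forall_inP=> _ /imsetP[i _ ->]; apply/forall_inP=> _ /imsetP[j _ ->].
apply/implyP; rewrite (inj_eq Finj) => ij.
by rewrite /= /blowup_adj /= /tensor_adj /= /complete_adj ij (inj_eq (addIr _)).
Qed.

Lemma rook_clique_number : clique_number G = n.+1.
Proof.
apply/eqP; rewrite eqn_leq; apply/andP; split.
  by apply/bigmax_leqP=> S; apply: rook_clique_le.
have [cl <-] := diagonalP (0, ord0).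
exact: (leq_bigmax_cond (F := fun S : {set G} => #|S|)).
Qed.

Lemma rook_diagonals : union_of_disjoint_maximal_cliques G (n.+1 * m.+1).
Proof.
have /and3P[/eqP covP trivP nP] := preim_partitionP diagonal [set: G].
have PE : preim_partition diagonal setT =
    [set diagonal @^-1: [set c] | c in [set: 'I_n.+1 * 'I_m.+1]].
  have eqc (x : G) : [set y in setT | diagonal x == diagonal y]
      = diagonal @^-1: [set diagonal x].
    by apply/setP=> y; rewrite !inE eq_sym.
  apply/setP=> S; apply/imsetP/imsetP=> -[c _ ->].
    by exists (diagonal c); rewrite ?eqc.
  have [_] := diagonalP c; case: (set_0Vmem (diagonal @^-1: [set c])) => [->|[x]].
    by rewrite cards0.
  by rewrite !inE => /eqP <- _; exists x; rewrite ?eqc.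
exists (preim_partition diagonal setT); split=> //.
  rewrite PE card_imset ?cardsT ?card_prod ?card_ord // => c d ecd.
  have [_] := diagonalP c; case: (set_0Vmem (diagonal @^-1: [set c])) => [->|[x xc]].
    by rewrite cards0.
  by move: (xc); rewrite ecd => /[!inE]/eqP <- _; move: xc; rewrite !inE => /eqP.
move=> S; rewrite PE => /imsetP[c _ ->]; have [cl card] := diagonalP c.
by rewrite /maximal_clique cl card rook_clique_number eqxx.
Qed.

End Rook.

(** * Invertible elements and idempotents of finite rings *)

(** Translation by x permutes V, hence preserves the sum of all elements. *)
Lemma card_mulrn (V : finZmodType) (x : V) : x *+ #|V| = 0.
Proof.
have /eqP : \sum_(y : V) (y + x) = \sum_(y : V) y.
  by rewrite [RHS](reindex_inj (addIr x)).
by rewrite big_split /= sumr_const -subr_eq0 addrAC subrr add0r => /eqP.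
Qed.

Section AdditiveFibres.
Variables (V W : finZmodType) (f : {additive V -> W}).

Lemma card_fibre x : #|[set y | f y == f x]| = #|[set y | f y == 0]|.
Proof.
rewrite -(card_imset [set y | f y == 0] (addrI x)); apply: eq_card => y.
rewrite !inE; apply/eqP/imsetP=> [fy|[z]].
  by exists (y - x); rewrite ?inE ?raddfB ?fy ?subrr // addrC subrK.
by rewrite inE => /eqP fz ->; rewrite raddfD fz addr0.
Qed.

Lemma card_ker_image : #|V| = (#|[set y | f y == 0%R]| * #|[set f x | x : V]|)%N.
Proof.
rewrite -[LHS]sum1_card (partition_big_imset f) /= mulnC -[RHS]sum_nat_const.
apply: eq_bigr => _ /imsetP[x _ ->]; rewrite -(card_fibre x) -sum1_card.
by apply: eq_bigl => y; rewrite !inE.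
Qed.

Lemma card_ker_surj :
  (forall y, exists x, f x = y) -> #|V| = (#|[set y | f y == 0%R]| * #|W|)%N.
Proof.
move=> f_surj; rewrite card_ker_image -[#|W|]cardsT; congr (_ * #|pred_of_set _|)%N.
by apply/setP=> y; rewrite inE; have [x <-] := f_surj y; rewrite imset_f.
Qed.

End AdditiveFibres.

(** For 0 < d < p the integers d and #|V| are coprime, and #|V| annihilates x; so
    d x = 0 would imply x = 0. *)
Lemma pgroup_mulrn_inj (V : finZmodType) (p n : nat) (x : V) :
    prime p -> #|V| = (p ^ n)%N -> x != 0 ->
  injective (fun i : 'I_p => x *+ i).
Proof.
move=> p_prime cardV x0.
suff inj (i j : 'I_p) : (i < j)%N -> x *+ i <> x *+ j.
  move=> i j eij; apply/val_inj/eqP; case: ltngtP => // /inj; first by case.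
  by move/esym: eij => eij; case.
move=> ij eij; case/eqP: x0.
have xd : x *+ (j - i) = 0 by rewrite mulrnBr ?(ltnW ij) // eij subrr.
have dp : coprime (j - i) #|V|.
  rewrite cardV coprimeXr // coprime_sym prime_coprime // gtnNdvd ?subn_gt0 //.
  exact: leq_ltn_trans (leq_subr _ _) _.
have j0 : (0 < j - i)%N by rewrite subn_gt0.
have [a b ab _] := egcdnP #|V| j0.
have := mulrnA x (j - i) a; rewrite mulnC ab mulrnDr (eqP dp) mulnC mulrnA card_mulrn.
by rewrite mul0rn add0r mulr1n xd mul0rn.
Qed.

Section FiniteRing.
Variable R : finNzRingType.
Implicit Types x y r : R.

Definition invertible x := [exists y, (x * y == 1) && (y * x == 1)].

Lemma invertibleP x : reflect (exists2 y, x * y = 1 & y * x = 1) (invertible x).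
Proof.
apply: (iffP existsP) => -[y]; first by case/andP=> /eqP ? /eqP ?; exists y.
by move=> xy yx; exists y; rewrite xy yx !eqxx.
Qed.

(** The powers of x are eventually periodic; an exponent that is a multiple of the
    period, and large enough, will do. *)
Lemma idempotent_power x : exists n, x ^+ n.+1 * x ^+ n.+1 = x ^+ n.+1.
Proof.
have [i [j ij eij]] : exists i : nat, exists2 j : nat, (i < j)%N & x ^+ i = x ^+ j.
  have /injectivePn[i [j ij eij]] : ~~ injectiveb (fun i : 'I_#|R|.+1 => x ^+ i).
    by apply/injectiveP=> /leq_card; rewrite card_ord ltnn.
  by move: ij; rewrite neq_ltn => /orP[] ?; [exists i, j | exists j, i].
pose d := (j - i)%N.
have per m k : (i <= m)%N -> x ^+ (m + k * d) = x ^+ m.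
  move=> im; elim: k => [|k IHk]; first by rewrite addn0.
  rewrite mulSn addnCA exprD IHk -exprD -[in RHS](subnK im) -{1}(subnKC im) addnA.
  by rewrite (addnC d) subnKC ?(ltnW ij) // exprD -eij -exprD addnC.
have d0 : (0 < d)%N by rewrite subn_gt0.
have le_i : (i <= i.+1 * d)%N by rewrite (leq_trans (leqnSn i)) ?leq_pmulr.
exists (i.+1 * d).-1; rewrite prednK ?muln_gt0 //.
by rewrite -exprD per.
Qed.

(** Finiteness enters through an idempotent power of y: being left invertible, it
    is 1, so that x is a power of y. *)
Lemma mulr1_comm x y : x * y = 1 -> y * x = 1.
Proof.
move=> xy; have [n yn] := idempotent_power y.
have xyn m : x ^+ m * y ^+ m = 1.
  elim: m => [|m IHm]; first by rewrite mulr1.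
  by rewrite exprSr exprS mulrA -[_ * x * y]mulrA xy mulr1.
have yn1 : y ^+ n.+1 = 1.
  by rewrite -[LHS]mul1r -(xyn n.+1) -mulrA yn.
have -> : x = y ^+ n by rewrite -[x]mulr1 -yn1 exprS mulrA xy mul1r.
by rewrite -exprS.
Qed.

Lemma invertible_l x y : y * x = 1 -> invertible x.
Proof. by move=> yx; apply/invertibleP; exists y; rewrite // mulr1_comm. Qed.

Lemma invertible_r x y : x * y = 1 -> invertible x.
Proof. by move/mulr1_comm; apply: invertible_l. Qed.

Lemma invertible_factor_l x y : invertible (x * y) -> invertible y.
Proof. by case/invertibleP=> z _; rewrite mulrA; apply: invertible_l. Qed.

Lemma invertible_factor_r x y : invertible (x * y) -> invertible x.
Proof. by case/invertibleP=> z; rewrite -mulrA => /invertible_r. Qed.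

Lemma invertible1 : invertible 1.
Proof. by apply: (@invertible_l _ 1); rewrite mulr1. Qed.

Lemma invertible_lreg x y : invertible x -> x * y = 0 -> y = 0.
Proof.
by case/invertibleP=> z _ zx xy; rewrite -[y]mul1r -zx -mulrA xy mulr0.
Qed.

Lemma invertible_rreg x y : invertible x -> y * x = 0 -> y = 0.
Proof.
by case/invertibleP=> z xz _ yx; rewrite -[y]mulr1 -xz mulrA yx mul0r.
Qed.

Lemma nilpotent_invertible x n : x ^+ n = 0 -> invertible (1 - x).
Proof.
move=> xn; apply: (@invertible_r _ (\sum_(i < n) x ^+ i)).
by rewrite -[1 - x]opprB mulNr -subrX1 xn sub0r opprK.
Qed.

End FiniteRing.

(** * The Jacobson radical *)

Section Jacobson.
Variable R : finNzRingType.
Implicit Types (x y r g : R) (M : {set R}).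

Lemma maximal_left_ideal_sum M x :
  maximal_left_ideal M -> x \notin M -> exists r, 1 - r * x \in M.
Proof.
move=> maxM; have [M0 M1 MM] := proper_left_idealP _ (maxsetp maxM).
pose L := [set a | [exists r, a - r * x \in M]].
have ML : M \subset L.
  by apply/subsetP=> m mM; rewrite inE; apply/existsP; exists 0; rewrite mul0r subr0.
move=> xM; suff : 1 \in L by rewrite inE => /existsP.
apply/negPn/negP=> L1; case/negP: xM; rewrite -(maxsetsup maxM _ ML).
  by rewrite inE; apply/existsP; exists 1; rewrite mul1r subrr.
apply/proper_left_idealP; split=> //; first exact: (subsetP ML).
move=> a u v; rewrite !inE => /existsP[r rM] /existsP[s sM].
apply/existsP; exists (a * r + s).
have -> : a * u + v - (a * r + s) * x = a * (u - r * x) + (v - s * x).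
  by rewrite mulrBr mulrDl mulrA opprD addrACA.
exact: MM.
Qed.

Lemma maximal_left_ideal_noninvertible M x :
  maximal_left_ideal M -> x \in M -> ~~ invertible x.
Proof.
move=> maxM xM; have [M0 M1 MM] := proper_left_idealP _ (maxsetp maxM).
apply/negP=> /invertibleP[y _ yx]; case/negP: M1.
by rewrite -yx -[y * x]addr0 MM.
Qed.

(** If 1 - r x is not invertible, it generates a proper left ideal, and no maximal
    left ideal containing it can contain x. *)
Lemma jacobsonP x : reflect (forall r, invertible (1 - r * x)) (x \in jacobson R).
Proof.
apply: (iffP bigcapP) => [xJ r | xinv M maxM]; last first.
  apply/negPn/negP=> /(maximal_left_ideal_sum maxM)[r].
  by move/(maximal_left_ideal_noninvertible maxM); rewrite xinv.
apply: contraT => ninv; pose I := [set a * (1 - r * x) | a : R].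
have idI : proper_left_ideal I.
  apply/proper_left_idealP; split.
  - by apply/imsetP; exists 0; rewrite ?mul0r.
  - apply/negP=> /imsetP[a _ a1]; case/negP: ninv.
    by apply: (@invertible_l _ _ a).
  move=> a _ _ /imsetP[b _ ->] /imsetP[c _ ->].
  by apply/imsetP; exists (a * b + c); rewrite // mulrDl mulrA.
have [M maxM IM] := maxset_exists idI.
have [_ M1 MM] := proper_left_idealP _ (maxsetp maxM).
case/negP: M1; rewrite -[1](subrK (r * x)) addrC; apply: MM; first exact: xJ.
by apply: (subsetP IM); apply/imsetP; exists 1; rewrite ?mul1r.
Qed.

Lemma jacobson_nilpotent x :
  (forall r, exists n, (r * x) ^+ n = 0) -> x \in jacobson R.
Proof.
move=> nil; apply/jacobsonP=> r; have [n] := nil r.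
exact: nilpotent_invertible.
Qed.

Lemma invertible_mod_jacobson x : 1 - x \in jacobson R -> invertible x.
Proof. by move=> /jacobsonP/(_ 1); rewrite mul1r opprB addrC subrK. Qed.

Lemma jacobson_idempotent g : g \in jacobson R -> g * g = g -> g = 0.
Proof.
move=> /jacobsonP/(_ 1) ginv gg; apply: (invertible_lreg ginv).
by rewrite mul1r mulrBl mul1r gg subrr.
Qed.

(** Some 1 - r x is not invertible, so r x is not nilpotent, and an idempotent power
    of r x is nonzero. All idempotents of the classification come from here. *)
Lemma notin_jacobson x : x \notin jacobson R ->
  exists r n, (r * x) ^+ n.+1 * (r * x) ^+ n.+1 = (r * x) ^+ n.+1
              /\ (r * x) ^+ n.+1 <> 0.
Proof.
move=> xJ; suff /existsP[r] : [exists r, ~~ invertible (1 - r * x)].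
  move=> ninv; have [n xn] := idempotent_power (r * x); exists r, n; split=> // x0.
  by rewrite (nilpotent_invertible x0) in ninv.
rewrite -negb_forall; apply: contra xJ => /forallP inv; exact/jacobsonP.
Qed.

(** No element of a maximal left ideal is invertible; so, if all elements outside
    the radical are, the radical is the only maximal left ideal. *)
Lemma local_ringP :
  local_ring R <-> (forall x, x \notin jacobson R -> invertible x).
Proof.
split=> [[M [maxM uniqM]] x | inv].
  have -> : jacobson R = M.
    apply/eqP; rewrite eqEsubset bigcap_inf //=.
    by apply/bigcapsP=> N /uniqM ->.
  move=> xM; have [r rx] := maximal_left_ideal_sum maxM xM.
  apply: (invertible_factor_l (x := r)); apply/invertible_mod_jacobson.
  by apply/bigcapP=> N /uniqM <-.
have JM M : maximal_left_ideal M -> jacobson R = M.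
  move=> maxM; apply/eqP; rewrite eqEsubset bigcap_inf //=.
  apply/subsetP=> x xM; apply/negPn/negP=> /inv.
  exact/negP/(maximal_left_ideal_noninvertible maxM).
have id0 : proper_left_ideal ([set 0] : {set R}).
  apply/proper_left_idealP; split; rewrite ?inE ?oner_eq0 //.
  by move=> a u v /set1P-> /set1P->; rewrite mulr0 addr0 inE.
have [M maxM _] := maxset_exists id0.
by exists M; split=> // N /JM <-; rewrite (JM M).
Qed.

Lemma jacobsonMl r x : x \in jacobson R -> r * x \in jacobson R.
Proof.
by move=> xJ; have [J0 _ JJ] := jacobson_idealr_closed R; rewrite -[r * x]addr0 JJ.
Qed.

Lemma jacobson0 : 0 \in jacobson R.
Proof. by have [] := jacobson_idealr_closed R. Qed.

Lemma jacobson1 : 1 \notin jacobson R.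
Proof. by have [] := jacobson_idealr_closed R. Qed.

End Jacobson.

(** Equivalently, f is surjective and its kernel lies in the radical. *)
Definition radical_map (R S : finNzRingType) (f : R -> S) : Prop :=
  (forall y, exists x, f x = y) /\ (forall x, invertible (f x) -> invertible x).

Section RadicalMap.
Variables (R S : finNzRingType) (f : {rmorphism R -> S}).

Lemma rmorph_invertible x : invertible x -> invertible (f x).
Proof.
case/invertibleP=> y xy yx.
by apply/invertibleP; exists (f y); rewrite -rmorphM ?xy ?yx rmorph1.
Qed.

Lemma radical_map_jacobson x : radical_map f ->
  (x \in jacobson R) = (f x \in jacobson S).
Proof.
move=> [f_surj f_inv]; apply/jacobsonP/jacobsonP=> inv r.
  by have [s <-] := f_surj r; rewrite -rmorphM -(rmorph1 f) -rmorphB rmorph_invertible.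
by apply: f_inv; rewrite rmorphB rmorph1 rmorphM.
Qed.

End RadicalMap.

(** * The quotient by the radical *)

(** The section [repr] embeds the quotient into R, so it is finite. *)
HB.instance Definition _ (R : finNzRingType) :=
  Choice_isCountable.Build (quot_jacobson R)
    (pcan_pickleK (can_pcan (@reprK R (quot_jacobson R)))).
HB.instance Definition _ (R : finNzRingType) :=
  isFinite.Build (quot_jacobson R)
    (@pcan_enumP _ R _ _ (can_pcan (@reprK R (quot_jacobson R)))).

Section Quotient.
Variable R : finNzRingType.

Definition to_quot (x : R) : quot_jacobson R := \pi x.

Fact to_quot_zmod_morphism : zmod_morphism to_quot.
Proof.
by move=> x y; apply: (addIr (to_quot y)); rewrite subrK -pi_quot_add subrK.
Qed.

Fact to_quot_monoid_morphism : monoid_morphism to_quot.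
Proof. by split=> // x y; apply: pi_quot_mul. Qed.

HB.instance Definition _ :=
  GRing.isZmodMorphism.Build R (quot_jacobson R) to_quot to_quot_zmod_morphism.
HB.instance Definition _ :=
  GRing.isMonoidMorphism.Build R (quot_jacobson R) to_quot to_quot_monoid_morphism.

Lemma to_quot_surj (y : quot_jacobson R) : exists x, to_quot x = y.
Proof. by exists (repr y); apply: reprK. Qed.

Lemma to_quot_eq0 x : (to_quot x == 0) = (x \in jacobson R).
Proof. by rewrite -(raddf0 to_quot) [LHS]pi_quot_eq subr0. Qed.

Lemma to_quot_radical_map : radical_map to_quot.
Proof.
split=> [|x /invertibleP[z xz _]]; first exact: to_quot_surj.
have [y yz] := to_quot_surj z; apply: (invertible_factor_r (y := y)).
apply: invertible_mod_jacobson.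
by rewrite -to_quot_eq0 rmorphB rmorph1 rmorphM /= yz xz subrr.
Qed.

Lemma card_quot_jacobson : #|R| = (#|jacobson R| * #|{: quot_jacobson R}|)%N.
Proof.
rewrite (card_ker_surj to_quot_surj); congr (#|pred_of_set _| * _)%N.
by apply/setP=> x; rewrite inE to_quot_eq0.
Qed.

End Quotient.

(** * Points of the projective line *)

(** Working with rows (u, w) of an invertible matrix as a basis of R^2 avoids
    computing with inverse matrices. *)
Section Basis.
Variable R : finNzRingType.
Implicit Types (u v w : 'rV[R]_2) (A : 'M[R]_2).

(** R^2 is finite, so an injective linear map is bijective, and the preimages of the
    rows of the identity form an inverse. *)
Lemma GL2P A : reflect (forall v, v *m A = 0 -> v = 0) (GL2 A).
Proof.
apply: (iffP existsP) => [[B /andP[/eqP AB _]] v vA | ker0].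
  by rewrite -[v]mulmx1 -AB mulmxA vA mul0mx.
have inj : injective (fun v => v *m A).
  move=> v w /eqP; rewrite -subr_eq0 -mulmxBl => /eqP/ker0/eqP.
  by rewrite subr_eq0 => /eqP.
have [g _ gK] := injF_bij inj.
pose B := \matrix_i g (row i 1%:M).
have BA : B *m A = 1%:M by apply/row_matrixP=> i; rewrite row_mul rowK gK.
exists B; rewrite BA eqxx andbT -subr_eq0; apply/eqP/row_matrixP=> i.
rewrite row0; apply: ker0; rewrite -row_mul mulmxBl -mulmxA BA mulmx1 mul1mx subrr.
by rewrite row0.
Qed.

Lemma mul_row2_col (a b : R) u w :
  row_mx a%:M b%:M *m col_mx u w = a *: u + b *: w.
Proof. by rewrite mul_row_col !mul_scalar_mx. Qed.

Lemma row2E (v : 'rV[R]_2) : exists a b : R, v = row_mx a%:M b%:M.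
Proof.
pose v' : 'rV_(1 + 1) := v; exists (lsubmx v' 0 0), (rsubmx v' 0 0).
by rewrite -!mx11_scalar hsubmxK.
Qed.

Lemma row2_inj (a b c d : R) :
  row_mx a%:M b%:M = row_mx c%:M d%:M :> 'rV[R]_(1 + 1) -> a = c /\ b = d.
Proof.
move=> /eq_row_mx[/matrixP/(_ 0 0) ac /matrixP/(_ 0 0) bd].
by move: ac bd; rewrite !mxE !mulr1n.
Qed.

Definition basis u w := GL2 (col_mx u w).

Lemma basisP u w :
  reflect (forall a b : R, a *: u + b *: w = 0 -> a = 0 /\ b = 0) (basis u w).
Proof.
apply: (iffP (GL2P _)) => [ker0 a b | free v].
  rewrite -mul_row2_col => /ker0 ab0; apply: row2_inj.
  by rewrite ab0 !raddf0 row_mx0.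
have [a [b ->]] := row2E v; rewrite mul_row2_col => /free[-> ->].
by rewrite !raddf0 row_mx0.
Qed.

Lemma basis_sym u w : basis u w -> basis w u.
Proof. exact: GL2_col_mxC. Qed.

Lemma basis_span u w : basis u w -> forall v, exists a b : R, v = a *: u + b *: w.
Proof.
move=> /existsP[B /andP[_ /eqP BA]] v; have [a [b vB]] := row2E (v *m B).
by exists a, b; rewrite -mul_row2_col -vB -mulmxA BA mulmx1.
Qed.

Lemma admissibleP u : reflect (exists w, basis u w) (admissible u).
Proof.
apply: (iffP existsP) => [[A /andP[GA /eqP <-]] | [w uw]].
  exists (row 1 A); rewrite /basis; suff -> : col_mx (row 0 A) (row 1 A) = A by [].
  by apply/row_matrixP=> i; rewrite -(splitK i); case: split => j; rewrite (ord1 j) /=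
    ?rowKu ?rowKd; apply/rowP=> k; rewrite !mxE; congr (A _ _); apply: val_inj.
exists (col_mx u w); apply/andP; split=> //; apply/eqP/rowP=> j.
by rewrite -[RHS](@col_mxEu _ 1 1 2 u w) mxE; congr (col_mx u w _ j); apply: val_inj.
Qed.

Lemma basis_admissible u w : basis u w -> admissible u.
Proof. by move=> uw; apply/admissibleP; exists w. Qed.

Lemma admissible_scaleI u (a b : R) : admissible u -> a *: u = b *: u -> a = b.
Proof.
move=> /admissibleP[w /basisP uw] /eqP; rewrite -subr_eq0 -scalerBl => /eqP ab.
by have [|/eqP] := uw (a - b) 0; rewrite ?ab ?scale0r ?addr0 // subr_eq0 => /eqP.
Qed.

Lemma basisZ u w (a : R) : invertible a -> basis u w -> basis (a *: u) w.
Proof.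
move=> ainv /basisP uw; apply/basisP=> c d; rewrite scalerA => /uw[ca ->].
by rewrite (invertible_rreg ainv ca).
Qed.

Lemma left_cyclic_id u : u \in left_cyclic u.
Proof. by apply/imsetP; exists 1; rewrite ?scale1r. Qed.

(** If u = a v and v = b u, then a b u = u, and a b = 1 because the admissible u can
    be cancelled. *)
Lemma left_cyclicP u v : admissible u ->
  reflect (exists2 a, invertible a & u = a *: v) (left_cyclic u == left_cyclic v).
Proof.
move=> uadm; apply: (iffP eqP) => [uv | [a /invertibleP[b ab ba] ->]].
  have := left_cyclic_id u; have := left_cyclic_id v.
  rewrite -uv {2}uv => /imsetP[b _ vb] /imsetP[a _ ua].
  exists a => //; apply: (@invertible_r _ _ b); apply: (admissible_scaleI uadm).
  by rewrite -scalerA -vb scale1r.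
apply/setP=> x; apply/imsetP/imsetP=> -[c _ ->].
  by exists (c * a); rewrite // scalerA.
by exists (c * b); rewrite // scalerA -mulrA ba mulr1.
Qed.

Lemma basis_inj u w (a b c d : R) :
  basis u w -> a *: u + b *: w = c *: u + d *: w -> a = c /\ b = d.
Proof.
move=> /basisP uw /eqP; rewrite -subr_eq0 opprD addrACA -!scalerBl => /eqP/uw[].
by move=> /eqP; rewrite subr_eq0 => /eqP-> /eqP; rewrite subr_eq0 => /eqP->.
Qed.

Lemma basis_shear u w (x : R) : basis u w -> basis (u + x *: w) w.
Proof.
move=> /basisP uw; apply/basisP=> a b.
rewrite scalerDr scalerA -addrA -scalerDl => /uw[->].
by rewrite mul0r add0r.
Qed.

Lemma basis_delta : basis (delta_mx 0 0) (delta_mx 0 1).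
Proof.
apply/basisP=> a b /matrixP ab0; have := ab0 0 1; have := ab0 0 0.
by rewrite !mxE /= !mulr1 !mulr0 addr0 add0r.
Qed.

Lemma pointP (P : point R) : exists2 u, admissible u & val P = left_cyclic u.
Proof. by have /imsetP[u uadm ->] := valP P; exists u. Qed.

Lemma mk_point u : admissible u -> exists P : point R, val P = left_cyclic u.
Proof.
move=> uadm; pose L P := P \in projective_line R.
by exists (exist L _ (imset_f (@left_cyclic R) uadm)).
Qed.

Lemma distantE (P Q : point R) u v : admissible u -> admissible v ->
  val P = left_cyclic u -> val Q = left_cyclic v -> distant P Q = basis u v.
Proof.
move=> uadm vadm Pu Qv; apply/existsP/idP=> [[u' /existsP[v' /and5P[_ _]]] | uv].
  rewrite Pu Qv => /(left_cyclicP _ uadm)[a ainv ->] /(left_cyclicP _ vadm)[b binv ->].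
  by move=> uv; do 2!apply/basisZ/basis_sym => //.
by exists u; apply/existsP; exists v; rewrite uadm vadm Pu Qv !eqxx.
Qed.

End Basis.

(** * Distant graphs *)

Section DivisionRing.
Variable D : finNzRingType.
Hypothesis D_inv : forall x : D, x != 0 -> invertible x.

Lemma division_basis (u v : 'rV[D]_2) :
  admissible u -> admissible v -> left_cyclic u != left_cyclic v -> basis u v.
Proof.
move=> uadm vadm uv; apply/basisP=> a b ab0.
have a0 : a = 0.
  apply/eqP; apply: contraR uv => /D_inv/invertibleP[c _ ca].
  have uE : u = - (c * b) *: v.
    rewrite scaleNr -scalerA -[u]scale1r -ca -scalerA; apply/eqP.
    by rewrite -subr_eq0 opprK -scalerDr ab0 scaler0.
  apply/left_cyclicP => //; exists (- (c * b)) => //.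
  apply: D_inv; apply: contraTneq uadm => cb0; rewrite uE cb0 scale0r.
  apply/negP=> /(@admissible_scaleI _ _ 1 0); rewrite !scaler0 => /(_ erefl)/eqP.
  by rewrite oner_eq0.
split=> //; apply: (admissible_scaleI vadm).
by rewrite scale0r -ab0 a0 scale0r add0r.
Qed.

Lemma division_complete : complete_graph (distant_graph D).
Proof.
move=> P Q; have [u uadm Pu] := pointP P; have [v vadm Qv] := pointP Q.
rewrite /= (distantE uadm vadm Pu Qv); apply/idP/idP=> [uv | PQ].
  apply/eqP=> PQ; have := distant_irrefl P.
  by rewrite {2}PQ (distantE uadm vadm Pu Qv) uv.
by apply: division_basis => //; rewrite -Pu -Qv (inj_eq val_inj).
Qed.

(** Points other than R e2 have a generator e1 + x e2, with a unique x. *)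
Lemma card_division_points : #|distant_graph D| = (#|D| + 1)%N.
Proof.
pose e1 : 'rV[D]_2 := delta_mx 0 0; pose e2 : 'rV[D]_2 := delta_mx 0 1.
have e12 : basis e1 e2 := basis_delta D.
have adm2 : admissible e2 := basis_admissible (basis_sym e12).
have adm1 x : admissible (e1 + x *: e2) := basis_admissible (basis_shear x e12).
pose h (o : option D) := left_cyclic (if o is Some x then e1 + x *: e2 else e2).
have h_inj : injective h.
  have ne x : left_cyclic e2 <> left_cyclic (e1 + x *: e2).
    move=> /eqP/(left_cyclicP _ adm2)[a _]; rewrite scalerDr scalerA => e.
    have [] := basis_inj (a := 0) (b := 1) (c := a) (d := a * x) e12.
      by rewrite scale0r add0r scale1r.
    by move=> <- /eqP; rewrite mul0r oner_eq0.
  move=> [x|] [y|] //; rewrite /h; last 2 first.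
  - by move/esym/ne.
  - by move/ne.
  move=> /eqP/(left_cyclicP _ (adm1 x))[a _]; rewrite scalerDr scalerA => e.
  have [] := basis_inj (a := 1) (b := x) (c := a) (d := a * y) e12.
    by rewrite scale1r.
  by move=> <- ->; rewrite mul1r.
rewrite card_sig addn1 -card_option -cardsT -(card_imset setT h_inj).
apply: eq_card => P; apply/imsetP/imsetP=> [[u uadm ->] | [o _ ->]]; last first.
  by case: o => [x|]; [exists (e1 + x *: e2); first exact: adm1 | exists e2].
have [a [b uE]] := basis_span e12 u; have [a0 | a0] := eqVneq a 0.
  exists None => //; apply/eqP/left_cyclicP => //; exists b; last first.
    by rewrite uE a0 scale0r add0r.
  apply: D_inv; apply: contraTneq uadm => b0; rewrite uE a0 b0 !scale0r addr0.
  apply/negP=> /(@admissible_scaleI _ _ 1 0); rewrite !scaler0 => /(_ erefl)/eqP.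
  by rewrite oner_eq0.
have /invertibleP[c ac _] := D_inv a0.
exists (Some (c * b)) => //; apply/eqP/left_cyclicP => //; exists a; first exact: D_inv.
by rewrite scalerDr !scalerA mulrA ac mul1r.
Qed.

Lemma division_iso : graph_iso (distant_graph D) (complete (#|D| + 1)).
Proof. exact: complete_iso division_complete card_division_points. Qed.

End DivisionRing.

(** By surjectivity the image of a cyclic submodule is again a cyclic submodule, so
    points can be mapped as sets, without choosing generators. *)
Section PointMap.
Variables (R S : finNzRingType) (f : {rmorphism R -> S}).
Hypothesis f_surj : forall y, exists x, f x = y.
Implicit Types (u w : 'rV[R]_2) (P Q : point R).

Lemma map_basis u w : basis u w -> basis (map_mx f u) (map_mx f w).
Proof.
case/existsP=> B /andP[/eqP AB /eqP BA]; apply/existsP; exists (map_mx f B).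
by rewrite -map_col_mx -!map_mxM AB BA map_mx1 eqxx.
Qed.

Lemma map_admissible u : admissible u -> admissible (map_mx f u).
Proof. by case/admissibleP=> w /map_basis/basis_admissible. Qed.

Lemma map_left_cyclic u : map_mx f @: left_cyclic u = left_cyclic (map_mx f u).
Proof.
apply/setP=> v; apply/imsetP/imsetP=> [[_ /imsetP[a _ ->] ->] | [b _ ->]].
  by exists (f a); rewrite // map_mxZ.
by have [a <-] := f_surj b; exists (a *: u); rewrite ?map_mxZ //; apply/imsetP; exists a.
Qed.

Fact map_point_subproof P : map_mx f @: val P \in projective_line S.
Proof.
have [u uadm ->] := pointP P; rewrite map_left_cyclic.
by apply: imset_f; apply: map_admissible.
Qed.

Definition map_point P : point S :=
  exist (fun X => X \in projective_line S) _ (map_point_subproof P).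

Lemma map_pointE P u : val P = left_cyclic u ->
  val (map_point P) = left_cyclic (map_mx f u).
Proof. by move=> /= ->; apply: map_left_cyclic. Qed.

Lemma map_mx_surj m n (B : 'M[S]_(m, n)) : exists A, map_mx f A = B.
Proof.
have /fin_all_exists[g gB] : forall ij, exists x, f x = B ij.1 ij.2.
  by move=> ij; apply: f_surj.
exists (\matrix_(i, j) g (i, j)); apply/matrixP=> i j.
by rewrite !mxE gB.
Qed.

End PointMap.

Section RadicalMapGraph.
Variables (R S : finNzRingType) (f : {rmorphism R -> S}).
Hypothesis f_rad : radical_map f.
Let f_surj := proj1 f_rad.
Let f_inv := proj2 f_rad.
Implicit Types (u w : 'rV[R]_2).

(** Gaussian elimination: M 0 0 and its Schur complement are mapped to 1, hence are
    invertible. *)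
Lemma radical_map_ker (M : 'M[R]_2) (v : 'rV_2) :
  map_mx f M = 1%:M -> v *m M = 0 -> v = 0.
Proof.
move=> /matrixP fM vM.
have inv x : f x = 1 -> invertible x by move=> fx; apply: f_inv; rewrite fx invertible1.
have := fM 0 0; have := fM 0 1; have := fM 1 1.
rewrite !mxE /= => fM11 fM01 fM00.
have /matrixP vM0 := vM; have := vM0 0 1; have := vM0 0 0.
rewrite !mxE !big_ord_recl !big_ord0 !addr0 /= (_ : lift 0 0 = 1 :> 'I_2); last first.
  exact: val_inj.
move=> v0 v1; have /invertibleP[c Mc cM] := inv _ fM00.
have v0E : v 0 0 = - (v 0 1 * M 1 0 * c).
  by apply/eqP; rewrite -addr_eq0 -{1}[v 0 0]mulr1 -Mc mulrA -mulrDl v0 mul0r.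
have v10 : v 0 1 = 0.
  apply: (@invertible_rreg _ (M 1 1 - M 1 0 * c * M 0 1)).
    by apply: inv; rewrite rmorphB fM11 rmorphM fM01 mulr0 subr0.
  by rewrite mulrBr addrC !mulrA -mulNr -v0E.
apply/rowP=> -[[|[|]]] // i; rewrite mxE.
  by rewrite (_ : Ordinal i = 0) ?v0E ?v10 ?mul0r ?oppr0 //; apply: val_inj.
by rewrite (_ : Ordinal i = 1) //; apply: val_inj.
Qed.

Lemma radical_map_basis u w : basis (map_mx f u) (map_mx f w) = basis u w.
Proof.
apply/idP/idP=> [|/map_basis //]; case/existsP=> B' /andP[/eqP AB _].
have [B BE] := map_mx_surj f_surj B'; apply/GL2P=> v vA.
apply: (@radical_map_ker (col_mx u w *m B)); last by rewrite mulmxA vA mul0mx.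
have /= colE : map_mx f (col_mx u w : 'M_2) = col_mx (map_mx f u) (map_mx f w) :> 'M_2.
  exact: (map_col_mx f u w).
by rewrite map_mxM colE BE.
Qed.

Lemma map_point_adj : {mono map_point f_surj : P Q / distant P Q}.
Proof.
move=> P Q; have [u uadm Pu] := pointP P; have [v vadm Qv] := pointP Q.
rewrite (distantE uadm vadm Pu Qv) -radical_map_basis.
by apply: distantE; rewrite ?map_admissible //; apply: map_pointE.
Qed.

(** The points above S f(u) are the R(u + x w) for x in the kernel of f, where
    (u, w) is a fixed basis. *)
Lemma card_map_point_fibre Q :
  #|[set P | map_point f_surj P == Q]| = #|[set x | f x == 0]|.
Proof.
have [v' /admissibleP[w' vw'] Qv] := pointP Q.
have [u uE] := map_mx_surj f_surj v'; have [w wE] := map_mx_surj f_surj w'.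
have uw : basis u w by rewrite -radical_map_basis uE wE.
pose h x := left_cyclic (u + x *: w).
have adm x : admissible (u + x *: w) := basis_admissible (basis_shear x uw).
have h_inj : injective h.
  move=> x y /eqP/(left_cyclicP _ (adm x))[a _]; rewrite scalerDr scalerA => e.
  have [] := basis_inj (a := 1) (b := x) (c := a) (d := a * y) uw.
    by rewrite scale1r.
  by move=> <- ->; rewrite mul1r.
rewrite -(card_imset _ h_inj) -(card_imset _ val_inj); apply: eq_card => P.
apply/imsetP/imsetP=> [[P0 + ->] | [x]]; rewrite inE.
  have [t tadm Pt] := pointP P0; rewrite -(inj_eq val_inj) (map_pointE f_surj Pt) Qv.
  case/(left_cyclicP _ (map_admissible f tadm)) => a' a'inv.
  have [a [b tE]] := basis_span uw t; rewrite {}tE in Pt tadm *.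
  rewrite -uE map_mxD !map_mxZ => e.
  have uwf : basis (map_mx f u) (map_mx f w) by rewrite radical_map_basis.
  have [] := basis_inj (a := f a) (b := f b) (c := a') (d := 0) uwf.
    by rewrite e scale0r addr0.
  move=> fa fb; have /f_inv ainv : invertible (f a) by rewrite fa.
  have /invertibleP[c ac ca] := ainv.
  exists (c * b); first by rewrite inE rmorphM fb mulr0.
  rewrite Pt; apply/eqP/left_cyclicP => //; exists a => //.
  by rewrite scalerDr !scalerA mulrA ac mul1r.
move=> /eqP fx ->; have [P0 Px] := mk_point (adm x); exists P0; rewrite ?Px //.
rewrite inE -(inj_eq val_inj) (map_pointE f_surj Px) Qv.
by rewrite map_mxD map_mxZ fx scale0r addr0 uE.
Qed.

Lemma radical_map_iso (m : nat) : #|R| = (m * #|S|)%N ->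
  graph_iso (distant_graph R) (blowup (distant_graph S) m).
Proof.
move=> cardR.
apply: (@blowup_fibres (distant_graph S) m (distant_graph R) (map_point f_surj)).
  exact: map_point_adj.
move=> Q; rewrite card_map_point_fibre; apply/eqP.
rewrite -(eqn_pmul2r (m := #|S|)); last by apply/card_gt0P; exists 0.
by rewrite -cardR (card_ker_surj f_surj).
Qed.

End RadicalMapGraph.

(* joins the finite type and the ring structures of a product *)
HB.instance Definition _ (S T : finNzRingType) := GRing.NzRing.on (S * T)%type.

Section ProductGraph.
Variables S T : finNzRingType.
Notation R := (S * T)%type.

Let fst_surj (y : S) : exists x : R, x.1 = y. Proof. by exists (y, 0). Qed.
Let snd_surj (y : T) : exists x : R, x.2 = y. Proof. by exists (0, y). Qed.

Let split_point (P : point R) : point S * point T :=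
  (map_point (f := fst) fst_surj P, map_point (f := snd) snd_surj P).

Let pair_row (u : 'rV[S]_2) (v : 'rV[T]_2) : 'rV[R]_2 := \row_i (u 0 i, v 0 i).

Let pair_rowP (u w : 'rV[R]_2) (a b : R) :
  a *: u + b *: w =
    pair_row (a.1 *: map_mx fst u + b.1 *: map_mx fst w)
             (a.2 *: map_mx snd u + b.2 *: map_mx snd w).
Proof. by apply/rowP=> i; rewrite !mxE. Qed.

Lemma basis_pair (u w : 'rV[R]_2) :
  basis u w = basis (map_mx fst u) (map_mx fst w) &&
              basis (map_mx snd u) (map_mx snd w).
Proof.
apply/idP/andP=> [uw | [/basisP uw1 /basisP uw2]].
  by split; apply: map_basis.
apply/basisP=> a b; rewrite pair_rowP => /rowP e.
have [] := uw1 a.1 b.1; first by apply/rowP=> i; have := e i; rewrite !mxE => -[].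
have [] := uw2 a.2 b.2; first by apply/rowP=> i; have := e i; rewrite !mxE => -[].
by case: a b {e} => [a1 a2] [b1 b2] /= -> -> -> ->.
Qed.

Lemma product_iso :
  graph_iso (distant_graph R) (tensor (distant_graph S) (distant_graph T)).
Proof.
exists split_point; last first.
  move=> P Q; have [u uadm Pu] := pointP P; have [v vadm Qv] := pointP Q.
  rewrite /= /tensor_adj /= (distantE uadm vadm Pu Qv) basis_pair.
  by congr (_ && _); apply: distantE; rewrite ?map_admissible //; apply: map_pointE.
have split_inj : injective split_point.
  move=> P Q PQ; have [u uadm Pu] := pointP P; have [v vadm Qv] := pointP Q.
  apply/val_inj; rewrite Pu Qv; apply/eqP/left_cyclicP => //.
  have /(congr1 val) := congr1 snd PQ; have /(congr1 val) := congr1 fst PQ.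
  rewrite (map_pointE (f := fst) fst_surj Pu) (map_pointE (f := fst) fst_surj Qv).
  rewrite (map_pointE (f := snd) snd_surj Pu) (map_pointE (f := snd) snd_surj Qv).
  move=> /eqP/(left_cyclicP _ (map_admissible fst uadm))[a /invertibleP[c ac ca] uva].
  move=> /eqP/(left_cyclicP _ (map_admissible snd uadm))[b /invertibleP[d bd db] uvb].
  exists (a, b).
    by apply: (@invertible_l _ _ (c, d)); apply: (f_equal2 pair ca db).
  apply/rowP=> i; have := congr1 (fun r : 'rV_2 => r 0 i) uva.
  have := congr1 (fun r : 'rV_2 => r 0 i) uvb.
  by rewrite !mxE => e2 e1; rewrite [LHS]surjective_pairing e1 e2.
have /fin_all_exists[g gK] : forall PQ, exists P, split_point P = PQ.
  move=> [P Q]; have [u /admissibleP[u' uu'] Pu] := pointP P.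
  have [v /admissibleP[v' vv'] Qv] := pointP Q.
  have pairK1 x y : map_mx fst (pair_row x y) = x by apply/rowP=> i; rewrite !mxE.
  have pairK2 x y : map_mx snd (pair_row x y) = y by apply/rowP=> i; rewrite !mxE.
  have : basis (pair_row u v) (pair_row u' v') by rewrite basis_pair !pairK1 !pairK2 uu'.
  move/basis_admissible/mk_point => [W Wuv]; exists W; congr pair; apply: val_inj.
    by rewrite (map_pointE (f := fst) fst_surj Wuv) pairK1.
  by rewrite (map_pointE (f := snd) snd_surj Wuv) pairK2.
by exists g => // P; apply: split_inj; rewrite gK.
Qed.

End ProductGraph.

(** * Idempotents and indecomposability *)

Lemma pair_mulE (S T : nzRingType) (a c : S) (b d : T) :
  ((a, b) * (c, d) : S * T) = (a * c, b * d).
Proof. by []. Qed.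

Section Corner.
Variables (R : finNzRingType) (e : R).

Definition corner_pred : {pred R} := fun x => e * x == x.

Fact corner_zmod_closed : zmod_closed corner_pred.
Proof.
split=> [|x y /eqP ex /eqP ey]; first by rewrite unfold_in mulr0.
by rewrite unfold_in mulrBr ex ey.
Qed.
HB.instance Definition _ := GRing.isZmodClosed.Build R corner_pred corner_zmod_closed.

Hypotheses (ee : e * e = e) (e_central : forall x, e * x = x * e) (e0 : e != 0).

(** The ring eR. The proofs are parameters because its ring structure depends on
    them. *)
Definition corner of e * e = e & (forall x, e * x = x * e) & e != 0 :=
  {x : R | x \in corner_pred}.
Notation C := (corner ee e_central e0).

HB.instance Definition _ := SubType.on C.
HB.instance Definition _ := Finite.on C.
HB.instance Definition _ := [SubChoice_isSubZmodule of C by <:].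

Fact corner_mul_subproof (x y : C) : val x * val y \in corner_pred.
Proof. by have := valP x; rewrite !unfold_in mulrA => /eqP->. Qed.
Definition corner_mul (x y : C) : C := Sub (val x * val y) (corner_mul_subproof x y).
Fact corner_one_subproof : e \in corner_pred.
Proof. exact/eqP. Qed.
Definition corner_one : C := Sub e corner_one_subproof.

Fact corner_mulA : associative corner_mul.
Proof. by move=> x y z; apply: val_inj; rewrite !SubK mulrA. Qed.
Fact corner_mul1l : left_id corner_one corner_mul.
Proof. by move=> x; apply: val_inj; rewrite !SubK; apply/eqP/(valP x). Qed.
Fact corner_mul1r : right_id corner_one corner_mul.
Proof. by move=> x; apply: val_inj; rewrite !SubK -e_central; apply/eqP/(valP x). Qed.
Fact corner_mulDl : left_distributive corner_mul +%R.
Proof. by move=> x y z; apply: val_inj; rewrite !(SubK, raddfD) /= mulrDl. Qed.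
Fact corner_mulDr : right_distributive corner_mul +%R.
Proof. by move=> x y z; apply: val_inj; rewrite !(SubK, raddfD) /= mulrDr. Qed.
Fact corner_one_neq0 : corner_one != 0.
Proof. by rewrite -(inj_eq val_inj) SubK raddf0. Qed.

HB.instance Definition _ := GRing.Zmodule_isNzRing.Build C
  corner_mulA corner_mul1l corner_mul1r corner_mulDl corner_mulDr corner_one_neq0.

Fact corner_proj_subproof x : e * x \in corner_pred.
Proof. by rewrite unfold_in mulrA ee. Qed.
Definition corner_proj (x : R) : C := Sub (e * x) (corner_proj_subproof x).

Fact corner_proj_zmod_morphism : zmod_morphism corner_proj.
Proof. by move=> x y; apply: val_inj; rewrite raddfB !SubK mulrBr. Qed.
Fact corner_proj_monoid_morphism : monoid_morphism corner_proj.
Proof.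
split=> [|x y]; apply: val_inj; rewrite !SubK ?mulr1 //.
by rewrite -mulrA [x * (e * y)]mulrA -e_central -mulrA [in RHS]mulrA ee.
Qed.
HB.instance Definition _ := GRing.isZmodMorphism.Build R C corner_proj
  corner_proj_zmod_morphism.
HB.instance Definition _ := GRing.isMonoidMorphism.Build R C corner_proj
  corner_proj_monoid_morphism.

End Corner.

Section IdempotentComplement.
Variables (R : finNzRingType) (e : R).
Hypothesis ee : e * e = e.

Lemma compl_idem : (1 - e) * (1 - e) = 1 - e.
Proof. by rewrite mulrBr mulrBl mulr1 mul1r mulrBl mul1r ee subrr subr0. Qed.

Lemma idem_mul_compl : e * (1 - e) = 0.
Proof. by rewrite mulrBr mulr1 ee subrr. Qed.

Lemma compl_mul_idem : (1 - e) * e = 0.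
Proof. by rewrite mulrBl mul1r ee subrr. Qed.

End IdempotentComplement.

(** Otherwise R is the product of eR and (1 - e)R. *)
Lemma indecomposable_central (R : finNzRingType) (e : R) :
  indecomposable R -> e * e = e -> (forall x, e * x = x * e) -> e = 0 \/ e = 1.
Proof.
move=> indec ee ec; have [|e0] := eqVneq e 0; first by left.
have [/eqP|f0] := eqVneq (1 - e) 0; first by rewrite subr_eq0 => /eqP; right.
have fc x : (1 - e) * x = x * (1 - e) by rewrite mulrBl mulrBr ec mulr1 mul1r.
have ff := compl_idem ee.
case: indec; pose C := corner ee ec e0; pose D := corner ff fc f0.
exists C, D; pose h x : C * D := (corner_proj ee ec e0 x, corner_proj ff fc f0 x).
have hB : zmod_morphism h by move=> x y; rewrite /h !rmorphB.
have hM : monoid_morphism h by split=> [|x y]; rewrite /h ?rmorph1 ?rmorphM.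
pose h1 := GRing.isZmodMorphism.Build _ _ h hB.
pose h2 := GRing.isMonoidMorphism.Build _ _ h hM.
pose H : {rmorphism R -> C * D} := HB.pack h h1 h2.
exists H; exists (fun y => val y.1 + val y.2) => [x | [x y]].
  by rewrite /= -mulrDl addrC subrK mul1r.
have /eqP ex : e * val x == val x := valP x.
have /eqP fy : (1 - e) * val y == val y := valP y.
congr pair; apply: val_inj; rewrite /= mulrDr.
  by rewrite ex -fy mulrA idem_mul_compl // mul0r addr0.
by rewrite fy -ex mulrA compl_mul_idem // mul0r add0r.
Qed.

Lemma central_indecomposable (R : finNzRingType) :
    (forall e : R, e * e = e -> (forall x, e * x = x * e) -> e = 0 \/ e = 1) ->
  indecomposable R.
Proof.
move=> triv [R1 [R2 [f [g fK gK]]]]; pose e := g (1, 0).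
have fe : f e = (1, 0) by rewrite /e gK.
have [||e0|e1] := triv e.
- by apply: (can_inj fK); rewrite rmorphM fe pair_mulE mulr1 mulr0.
- move=> x; apply: (can_inj fK); rewrite !rmorphM fe; case: (f x) => a b.
  by rewrite !pair_mulE mul1r mulr1 mul0r mulr0.
- have := fe; rewrite e0 rmorph0 => /(congr1 fst)/eqP.
  by rewrite eq_sym oner_eq0.
have := fe; rewrite e1 rmorph1 => /(congr1 snd)/eqP.
by rewrite oner_eq0.
Qed.

(** * Matrix units *)

(** Here u = e u (1 - e). Since u is outside the radical, some i = s u is a nonzero
    idempotent; then x = u i in e R (1 - e) and y = (1 - e) i s e in (1 - e) R e are
    the matrix units E01 and E10. *)
Lemma matrix_unit_pair (R : finNzRingType) (e u : R) :
    e * e = e -> e * u = u -> u * e = 0 -> u \notin jacobson R ->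
  exists x y : R, [/\ x * y * x = x, y * x * y = y, x * x = 0, y * y = 0
                 & x * y <> 0].
Proof.
move=> ee eu ue uJ.
have [i [s [ii i0 su]]] : exists i s, [/\ i * i = i, i <> 0 & s * u = i].
  have [r [n [ii i0]]] := notin_jacobson uJ.
  by exists ((r * u) ^+ n.+1), ((r * u) ^+ n * r); rewrite -mulrA -exprSr.
have ie : i * e = 0 by rewrite -su -mulrA ue mulr0.
have iu : i * u = 0 by rewrite -eu mulrA ie mul0r.
have ifi : i * (1 - e) = i by rewrite mulrBr mulr1 ie subr0.
have yx : (1 - e) * i * s * e * (u * i) = (1 - e) * i.
  by rewrite -!mulrA [e * (u * i)]mulrA eu [s * (u * i)]mulrA su !ii.
have xyx : u * i * ((1 - e) * i * s * e) * (u * i) = u * i.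
  by rewrite -[LHS]mulrA yx mulrA -[u * i * _]mulrA ifi -mulrA ii.
exists (u * i), ((1 - e) * i * s * e); split=> //.
- by rewrite yx -!mulrA [i * ((1 - e) * _)]mulrA ifi [i * (i * _)]mulrA ii.
- by rewrite mulrA -[u * i * u]mulrA iu mulr0 mul0r.
- by rewrite -[_ * e]mulrA !mulrA -[_ * e * (1 - e)]mulrA idem_mul_compl // mulr0 !mul0r.
move=> xy0; case: i0; have <- : s * (u * i) = i by rewrite mulrA su.
by rewrite -xyx xy0 mul0r mulr0.
Qed.

(** The matrix units are E00 = x y, E01 = x, E10 = y and E11 = y x. *)
Section MatrixUnits.
Variables (R : finNzRingType) (p : nat).
Hypothesis pR : p \in [pchar R].
Variables x y : R.
Hypotheses (xyx : x * y * x = x) (yxy : y * x * y = y).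
Hypotheses (xx : x * x = 0) (yy : y * y = 0) (xy0 : x * y <> 0).
Let A := pPrimeCharType pR.

Let unit (a b : bool) : R :=
  if a then (if b then x * y else x) else (if b then y else y * x).

Let unitM a b c d : unit a b * unit c d = if b == c then unit a d else 0.
Proof.
have xyy : x * y * y = 0 by rewrite -mulrA yy mulr0.
have yxx : y * x * x = 0 by rewrite -mulrA xx mulr0.
by case: a b c d => [] [] [] [] /=;
   rewrite ?mulrA ?xyx ?yxy ?xyy ?yxx ?xx ?yy ?mul0r.
Qed.

Let E (i j : 'I_2) : A := unit (i == 0) (j == 0).

Let EM i j k l : E i j * E k l = if j == k then E i l else 0.
Proof.
rewrite [LHS]unitM (_ : (j == 0) == (k == 0) = (j == k)) //.
by case: j k => [[|[|[]]] // ?] [[|[|[]]]].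
Qed.

Let E00 : E 0 0 <> 0. Proof. by []. Qed.

Definition matrix_units_map (M : 'M['F_p]_2) : A := \sum_i \sum_j M i j *: E i j.

Fact matrix_units_map_zmod_morphism : zmod_morphism matrix_units_map.
Proof.
move=> M N; rewrite /matrix_units_map -sumrB; apply: eq_bigr => i _.
by rewrite -sumrB; apply: eq_bigr => j _; rewrite !mxE scalerBl.
Qed.

Lemma matrix_units_mapM : {morph matrix_units_map : M N / M *m N >-> M * N}.
Proof.
move=> M N; rewrite /matrix_units_map mulr_suml; apply: eq_bigr => i _.
transitivity (\sum_j \sum_l M i l *: (N l j *: E i j)).
  apply: eq_bigr => j _; rewrite mxE scaler_suml.
  by apply: eq_bigr => l _; rewrite scalerA.
rewrite exchange_big mulr_suml; apply: eq_bigr => j _.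
rewrite [RHS]mulr_sumr [RHS](bigD1 j) //= [X in _ + X]big1 ?addr0 => [|k kj].
  by rewrite mulr_sumr; apply: eq_bigr => l _; rewrite -scalerAl -scalerAr EM eqxx.
rewrite mulr_sumr big1 // => l _.
by rewrite -scalerAl -scalerAr EM eq_sym (negPf kj) !scaler0.
Qed.

(** E 0 i * M * E j 0 isolates the entry M i j, as a multiple of E 0 0. *)
Lemma matrix_units_map_inj : injective matrix_units_map.
Proof.
suff ker M : matrix_units_map M = 0 -> M = 0.
  move=> M N MN; apply/eqP; rewrite -subr_eq0; apply/eqP/ker.
  by rewrite matrix_units_map_zmod_morphism MN subrr.
move=> M0; apply/matrixP=> i j; rewrite mxE.
have : E 0 i * matrix_units_map M * E j 0 = M i j *: E 0 0.
  rewrite /matrix_units_map mulr_sumr mulr_suml (bigD1 i) //= [X in _ + X]big1.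
    rewrite addr0 mulr_sumr mulr_suml (bigD1 j) //= [X in _ + X]big1.
      by rewrite addr0 -scalerAr -scalerAl EM eqxx EM eqxx.
    move=> k kj.
    by rewrite -scalerAr -scalerAl EM eqxx EM (negPf kj) scaler0.
  move=> k ki; rewrite mulr_sumr mulr_suml big1 // => l _.
  by rewrite -scalerAr EM eq_sym (negPf ki) scaler0 mul0r.
rewrite M0 mulr0 mul0r => /esym/eqP; rewrite scaler_eq0.
by case/orP=> /eqP.
Qed.

End MatrixUnits.

Lemma ring_iso_sym (R S : nzRingType) : ring_iso R S -> ring_iso S R.
Proof.
move=> [f [g fK gK]].
have gB := can2_zmod_morphism fK gK; have gM := can2_monoid_morphism fK gK.
pose h1 := GRing.isZmodMorphism.Build _ _ g gB.
pose h2 := GRing.isMonoidMorphism.Build _ _ g gM.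
pose h : {rmorphism S -> R} := HB.pack g h1 h2.
by exists h; exists f.
Qed.

(** * Classification of the indecomposable rings of order p^4 *)

(** The multiples of p are nilpotent, since p^n annihilates R. *)
Lemma pchar_jacobson (R : finNzRingType) (p n : nat) :
  #|R| = (p ^ n)%N -> p%:R \in jacobson R.
Proof.
move=> cardR; apply: jacobson_nilpotent => r; exists n.
rewrite exprMn_comm; last exact/commr_nat.
by rewrite -natrX -cardR card_mulrn mulr0.
Qed.

Section Classification.
Variables (R : finNzRingType) (p : nat).
Hypotheses (p_prime : prime p) (cardR : #|R| = (p ^ 4)%N).
Implicit Types e g u x : R.

Lemma pchar_quot_jacobson : p \in [pchar (quot_jacobson R)].
Proof.
apply/andP; split=> //; rewrite -(rmorph_nat (@to_quot R)) to_quot_eq0.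
exact: pchar_jacobson cardR.
Qed.

Lemma card_matrix2 : #|{: 'M['F_p]_2}| = (p ^ 4)%N.
Proof. by rewrite card_mx card_Fp. Qed.

(** Matrix units in R/J would embed the p^4 matrices over F_p. *)
Lemma offdiag_jacobson e u : (#|{: quot_jacobson R}| < p ^ 4)%N ->
  e * e = e -> e * u = u -> u * e = 0 -> u \in jacobson R.
Proof.
move=> lt ee eu ue; apply: contraLR lt => uJ; rewrite -leqNgt -card_matrix2.
have [x [y [xyx yxy xx yy xy0]]] := matrix_unit_pair ee eu ue uJ.
have qM := rmorphM (@to_quot R).
have xy0' : to_quot x * to_quot y <> 0.
  move=> /eqP; rewrite -qM to_quot_eq0 => xyJ; apply: xy0.
  by apply: jacobson_idempotent => //; rewrite mulrA xyx.
have xyx' : to_quot x * to_quot y * to_quot x = to_quot x.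
  by rewrite -(qM x y) -(qM (x * y)) xyx.
have yxy' : to_quot y * to_quot x * to_quot y = to_quot y.
  by rewrite -(qM y x) -(qM (y * x)) yxy.
have xx' : to_quot x * to_quot x = 0 by rewrite -qM xx rmorph0.
have yy' : to_quot y * to_quot y = 0 by rewrite -qM yy rmorph0.
pose f M : quot_jacobson R :=
  matrix_units_map pchar_quot_jacobson (to_quot x) (to_quot y) M.
have f_inj : injective f.
  exact: (matrix_units_map_inj xyx' yxy' xx' yy' xy0').
exact: (leq_card f f_inj).
Qed.

(** Indeed e x - x e = e x (1 - e) - (1 - e) x e. *)
Lemma offdiag_central e : e * e = e ->
    (forall e' u, e' * e' = e' -> e' * u = u -> u * e' = 0 ->
       e' \in [:: e; 1 - e] -> u = 0) ->
  forall x, e * x = x * e.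
Proof.
move=> ee off x.
have ff := compl_idem ee; have ef := idem_mul_compl ee; have fe := compl_mul_idem ee.
have e0 : e * x * (1 - e) = 0.
  apply: (off e) => //; last by rewrite inE eqxx.
    by rewrite !mulrA ee.
  by rewrite -mulrA fe mulr0.
have f0 : (1 - e) * x * e = 0.
  apply: (off (1 - e)) => //; last by rewrite !inE eqxx orbT.
    by rewrite !mulrA ff.
  by rewrite -[LHS]mulrA ef mulr0.
have -> : e * x = e * x * e by apply/eqP; rewrite -subr_eq0 -{1}[e * x]mulr1 -mulrBr e0.
apply/esym/eqP; rewrite -subr_eq0.
have -> : x * e - e * x * e = (1 - e) * x * e by rewrite !mulrBl mul1r.
by rewrite f0.
Qed.

(** If J has order p, its two-sided annihilator is too large to lie in J, so it
    contains a nonzero idempotent g. The elements of g R (1 - g) and (1 - g) R g lie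
    in J, because R/J has only p^3 elements, and are annihilated by g; so g is central. *)
Lemma no_jacobson_p : #|jacobson R| = p -> ~ indecomposable R.
Proof.
move=> cardJ indec; have p_gt1 := prime_gt1 p_prime.
have [u uJ u0] : exists2 u, u \in jacobson R & u != 0.
  have : (1 < #|jacobson R|)%N by rewrite cardJ.
  case/card_gt1P=> a [b [aJ bJ ab]].
  by have [a0|] := eqVneq a 0; [exists b; rewrite // -a0 eq_sym | exists a].
have JuE x : x \in jacobson R -> exists i, x = u *+ i.
  suff <- : [set u *+ i | i : 'I_p] = jacobson R by case/imsetP=> i _ ->; exists i.
  apply/eqP; rewrite eqEcard cardJ card_imset; last first.
    exact: (pgroup_mulrn_inj p_prime cardR).
  rewrite card_ord leqnn andbT; apply/subsetP=> _ /imsetP[i _ ->].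
  by rewrite -mulr_natl jacobsonMl.
pose h x : R * R := (x * u, u * x).
have hB : zmod_morphism h by move=> x y; rewrite /h mulrBl mulrBr.
pose hB' := GRing.isZmodMorphism.Build _ _ h hB.
pose H : {additive R -> R * R} := HB.pack h hB'.
(* J x J has p^2 elements, so the kernel has at least p^2 of the p^4 elements of R *)
have ker_gt : (p < #|[set x | H x == 0%R]|)%N.
  have : (#|[set H x | x : R]| <= p * p)%N.
    rewrite -{1}cardJ -[in X in (_ * X)%N]cardJ -cardsX; apply: subset_leq_card.
    by apply/subsetP=> _ /imsetP[x _ ->]; rewrite inE jacobsonMl ?jacobsonMr.
  rewrite -(leq_pmul2l (m := #|[set x | H x == 0%R]|)) -?card_ker_image; last first.
    by apply/card_gt0P; exists 0; rewrite inE raddf0.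
  rewrite cardR (expnD p 2 2) leq_pmul2r ?expn_gt0 ?prime_gt0 //.
  by apply: leq_trans; rewrite -[X in (X < _)%N]expn1 ltn_exp2l.
have [x [xu ux xJ]] : exists x, [/\ x * u = 0, u * x = 0 & x \notin jacobson R].
  have /subsetPn[x] : ~~ ([set x | H x == 0] \subset jacobson R).
    by apply: contraL ker_gt => /subset_leq_card; rewrite cardJ -leqNgt.
  by rewrite inE => /eqP[xu ux] xJ; exists x.
have [r [n]] := notin_jacobson xJ; set g := (r * x) ^+ n.+1 => -[gg g0].
have gu : g * u = 0 by rewrite /g exprSr -!mulrA xu !mulr0.
have ug : u * g = 0.
  have [i ur] := JuE (u * r) (jacobsonMr _ uJ).
  by rewrite /g exprS !mulrA ur mulrnAl ux mul0rn mul0r.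
have gc : forall y, g * y = y * g.
  apply: offdiag_central gg _ => e v ee ev ve.
  have vJ : v \in jacobson R.
    apply: (offdiag_jacobson _ ee ev ve).
    rewrite -cardR card_quot_jacobson cardJ ltn_Pmull //.
    by apply/card_gt0P; exists 0.
  have [i vE] := JuE v vJ; rewrite !inE => /orP[] /eqP eE.
    by rewrite -ev eE vE mulrnAr gu mul0rn.
  have <- : v * g = v by rewrite -{2}[v]mulr1 -(subrK g 1) -eE mulrDr ve add0r.
  by rewrite vE mulrnAl ug mul0rn.
have [//|g1] := indecomposable_central indec gg gc.
by move: u0; rewrite -[u]mul1r -g1 gu eqxx.
Qed.

(** The images E and F of e and 1 - e are nonzero because the radical contains no
    nonzero idempotent; they span a copy of F_p x F_p in R/J. *)
Section SplitQuotient.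
Variable e : R.
Hypotheses (ee : e * e = e) (e0 : e <> 0) (e1 : e <> 1).
Let A := pPrimeCharType pchar_quot_jacobson.
Let E : A := to_quot e.
Let F : A := 1 - E.

Let EE : E * E = E.
Proof. by have /= := rmorphM (@to_quot R) e e; rewrite ee. Qed.
Let FF : F * F = F. Proof. by rewrite /F mulrBr mulr1 mulrBl mul1r EE subrr subr0. Qed.
Let EF : E * F = 0. Proof. by rewrite mulrBr mulr1 EE subrr. Qed.
Let FE : F * E = 0. Proof. by rewrite mulrBl mul1r EE subrr. Qed.
Let E0 : E != 0.
Proof. by rewrite [_ == _]to_quot_eq0; apply/negP=> /jacobson_idempotent/(_ ee). Qed.
Let F0 : F != 0.
Proof.
have -> : F = to_quot (1 - e) by rewrite rmorphB rmorph1.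
rewrite [_ == _]to_quot_eq0; apply/negP=> /jacobson_idempotent/(_ (compl_idem ee))/eqP.
by rewrite subr_eq0 eq_sym => /eqP.
Qed.

Definition split_map (ab : 'F_p * 'F_p) : A := ab.1 *: E + ab.2 *: F.

Fact split_map_zmod_morphism : zmod_morphism split_map.
Proof. by move=> [a b] [c d]; rewrite /split_map /= !scalerBl opprD addrACA. Qed.

Fact split_map_monoid_morphism : monoid_morphism split_map.
Proof.
split=> [|[a b] [c d]]; first by rewrite /split_map /= !scale1r addrC subrK.
rewrite /split_map pair_mulE /= mulrDl !mulrDr -!scalerAl -!scalerAr.
by rewrite EE FF EF FE !scaler0 addr0 add0r !scalerA.
Qed.

Lemma split_map_inj : injective split_map.
Proof.
suff ker ab : split_map ab = 0 -> ab = 0.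
  move=> x y xy; apply/eqP; rewrite -subr_eq0; apply/eqP/ker.
  by rewrite split_map_zmod_morphism xy subrr.
case: ab => a b; rewrite /split_map /= => ab0.
have := congr1 (fun z => z * E) ab0; have := congr1 (fun z => z * F) ab0.
rewrite !mulrDl -!scalerAl EE FF EF FE !scaler0 !mul0r addr0 add0r.
by move=> /eqP; rewrite scaler_eq0 (negPf F0) orbF => /eqP->
          /eqP; rewrite scaler_eq0 (negPf E0) orbF => /eqP->.
Qed.

Lemma card_quot_ge : (p ^ 2 <= #|{: quot_jacobson R}|)%N.
Proof.
have := leq_card _ split_map_inj.
by rewrite card_prod card_Fp // mulnn.
Qed.

Lemma split_quot_iso : #|{: quot_jacobson R}| = (p ^ 2)%N ->
  ring_iso (quot_jacobson R) ('F_p * 'F_p)%type.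
Proof.
move=> cardS; apply: ring_iso_sym.
pose h1 := GRing.isZmodMorphism.Build _ _ split_map split_map_zmod_morphism.
pose h2 := GRing.isMonoidMorphism.Build _ _ split_map split_map_monoid_morphism.
pose h : {rmorphism ('F_p * 'F_p)%type -> A} := HB.pack split_map h1 h2.
exists h; apply: inj_card_bij split_map_inj _.
by rewrite [leqLHS]cardS card_prod card_Fp // mulnn.
Qed.

End SplitQuotient.

(** As e is not central, there are matrix units, and they span R, which has only
    p^4 elements. *)
Lemma semisimple_matrix_iso e : jacobson R = [set 0] -> indecomposable R ->
  e * e = e -> e <> 0 -> e <> 1 -> ring_iso 'M['F_p]_2 R.
Proof.
move=> J0 indec ee e0 e1.
have pR : p \in [pchar R].
  by apply/andP; split=> //; rewrite -in_set1 -J0 (pchar_jacobson cardR).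
have [e' [u [ee' eu ue uJ]]] : exists e' u,
    [/\ e' * e' = e', e' * u = u, u * e' = 0 & u \notin jacobson R].
  suff /existsP[e' /existsP[u /and4P[/eqP ? /eqP ? /eqP ? ?]]] :
    [exists e', exists u,
      [&& e' * e' == e', e' * u == u, u * e' == 0 & u \notin jacobson R]].
    by exists e', u.
  apply: contraPT isT => /existsPn ne _.
  have [] // := indecomposable_central indec ee.
  apply: offdiag_central ee _ => e' u ee' eu ue _; apply/eqP; apply: contraT => u0.
  have := ne e'; case/existsP; exists u.
  by rewrite ee' eu ue !eqxx J0 inE u0.
have [x [y [xyx yxy xx yy xy0]]] := matrix_unit_pair ee' eu ue uJ.
pose h := @matrix_units_map R p pR x y.
have h_bij : bijective h.
  apply: inj_card_bij (matrix_units_map_inj xyx yxy xx yy xy0) _.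
  by rewrite card_matrix2 [leqLHS]cardR.
have hM : monoid_morphism h.
  have mor := matrix_units_mapM pR xyx yxy xx yy.
  split=> //; have [g _ gK] := h_bij.
  by have := mor 1%:M (g 1); rewrite -/h mul1mx gK mulr1 => <-.
pose h1 := GRing.isZmodMorphism.Build _ _ h (@matrix_units_map_zmod_morphism R p pR x y).
pose h2 := GRing.isMonoidMorphism.Build _ _ h hM.
pose H : {rmorphism 'M['F_p]_2 -> R} := HB.pack h h1 h2.
by exists H.
Qed.

(** Outside the radical some power of some r x is 1. *)
Lemma trivial_idempotents_local :
  (forall e, e * e = e -> e = 0 \/ e = 1) -> local_ring R.
Proof.
move=> triv; apply/local_ringP => x /notin_jacobson[r [n [idem ne0]]].
have [//|] := triv _ idem; rewrite exprSr mulrA; exact: invertible_l.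
Qed.

(** By cases on k, where #|J| = p ^ k, and on the existence of a nontrivial
    idempotent e; for k = 3, the quotient R/J has only p elements, too few for e. *)
Lemma indecomposable_cases : indecomposable R ->
  [\/ forall x, x != 0 -> invertible x,
      local_ring R /\ #|jacobson R| = (p ^ 2)%N,
      local_ring R /\ #|jacobson R| = (p ^ 3)%N
    | ring_iso (quot_jacobson R) ('F_p * 'F_p)%type \/ ring_iso 'M['F_p]_2 R].
Proof.
move=> indec.
have /dvdn_pfactor[] // : (#|jacobson R| %| p ^ 4)%N.
  by rewrite -cardR card_quot_jacobson dvdn_mulr.
move=> k k4 cardJ; have cardS := card_quot_jacobson R.
have JS_gt0 : (0 < #|jacobson R|)%N by rewrite cardJ expn_gt0 prime_gt0.
have {cardS} cardS : #|{: quot_jacobson R}| = (p ^ (4 - k))%N.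
  apply/eqP; rewrite -(eqn_pmul2l JS_gt0) -cardS cardR cardJ -expnD subnKC //.
have J0 : k = 0%N -> jacobson R = [set 0].
  move=> k0; move: cardJ; rewrite k0 => /eqP/cards1P[x Jx].
  by have := jacobson0 R; rewrite Jx inE => /eqP->.
have k1 : k <> 1%N by move=> k1; apply: no_jacobson_p indec; rewrite cardJ k1.
have k_ne4 : k <> 4%N.
  move=> k4'; have : (1 < #|{: quot_jacobson R}|)%N.
    by apply/card_gt1P; exists 0, 1; rewrite !inE eq_sym oner_eq0.
  by rewrite cardS k4'.
have [/existsP[e /and3P[/eqP ee /eqP e0 /eqP e1]] | triv] :=
    boolP [exists e : R, [&& e * e == e, e != 0 & e != 1]].
  have := card_quot_ge ee e0 e1; rewrite cardS leq_exp2l ?(prime_gt1 p_prime) // => k2.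
  case: k k4 k1 J0 cardJ cardS k2 {k_ne4} => [|[|[|[|k]]]] //= _ _ J0 _ cardS.
    by move=> _; apply: Or44; right; apply: semisimple_matrix_iso ee e0 e1; rewrite ?J0.
  by move=> _; apply: Or44; left; apply: split_quot_iso ee e0 e1 cardS.
have loc : local_ring R.
  apply: trivial_idempotents_local => e ee.
  move/existsPn/(_ e): triv; rewrite ee eqxx /= negb_and !negbK.
  by case/orP=> /eqP; [left | right].
case: k k4 k1 k_ne4 J0 cardJ cardS => [|[|[|[|[|k]]]]] // _ _ _ J0 cardJ cardS.
- apply: Or41 => x x0; apply: (proj1 (local_ringP R) loc).
  by rewrite J0 // inE.
- exact: Or42.
- exact: Or43.
Qed.

End Classification.

(** * Examples *)

(** The trivial extension of S by the bimodule K^n, on which S acts through l on the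
    left and through r on the right. The bimodule is an ideal of square zero. The same
    construction gives local rings, with l and r the identity, and rings of triangular
    matrices, with l and r the projections of a product. *)
Section TrivialExtension.
Variables (S : finNzRingType) (K : finComNzRingType) (l r : {rmorphism S -> K}) (n : nat).

Definition trivext of {rmorphism S -> K} & {rmorphism S -> K} : Type :=
  (S * 'rV[K]_n)%type.
Notation T := (trivext l r).

HB.instance Definition _ := Finite.on T.
HB.instance Definition _ := GRing.Zmodule.on T.

Definition trivext_mul (x y : T) : T :=
  (x.1 * y.1, l x.1 *: y.2 + r y.1 *: x.2).
Definition trivext_one : T := (1, 0).

Fact trivext_mulA : associative trivext_mul.
Proof.
move=> [a u] [b v] [c w]; congr pair; rewrite /= ?mulrA //.
rewrite !scalerDr !scalerA -!rmorphM addrA; congr (_ + _ + _).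
  by rewrite [r _ * l _]mulrC.
by rewrite !rmorphM [r c * _]mulrC.
Qed.
Fact trivext_mul1l : left_id trivext_one trivext_mul.
Proof. by move=> [a u]; rewrite /trivext_mul /= rmorph1 scale1r scaler0 addr0 mul1r. Qed.
Fact trivext_mul1r : right_id trivext_one trivext_mul.
Proof. by move=> [a u]; rewrite /trivext_mul /= rmorph1 scale1r scaler0 add0r mulr1. Qed.
Fact trivext_mulDl : left_distributive trivext_mul +%R.
Proof.
move=> [a u] [b v] [c w]; congr pair; rewrite /= ?mulrDl //.
by rewrite rmorphD scalerDl scalerDr addrACA.
Qed.
Fact trivext_mulDr : right_distributive trivext_mul +%R.
Proof.
move=> [a u] [b v] [c w]; congr pair; rewrite /= ?mulrDr //.
by rewrite rmorphD scalerDl scalerDr addrACA.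
Qed.
Fact trivext_one_neq0 : trivext_one != 0.
Proof. by apply/eqP=> /(congr1 fst)/eqP; rewrite oner_eq0. Qed.

HB.instance Definition _ := GRing.Zmodule_isNzRing.Build T
  trivext_mulA trivext_mul1l trivext_mul1r trivext_mulDl trivext_mulDr trivext_one_neq0.

Definition trivext_proj (x : T) : S := x.1.

Fact trivext_proj_zmod_morphism : zmod_morphism trivext_proj.
Proof. by []. Qed.
Fact trivext_proj_monoid_morphism : monoid_morphism trivext_proj.
Proof. by []. Qed.
HB.instance Definition _ := GRing.isZmodMorphism.Build T S trivext_proj
  trivext_proj_zmod_morphism.
HB.instance Definition _ := GRing.isMonoidMorphism.Build T S trivext_proj
  trivext_proj_monoid_morphism.

Lemma trivext_radical_map : radical_map trivext_proj.
Proof.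
split=> [a | [a u] /invertibleP[b ab ba]]; first by exists (a, 0).
apply: (@invertible_r _ _ ((b, - (l b * r b) *: u) : T)); congr pair => //=.
by rewrite scalerA mulrN mulrA -rmorphM ab rmorph1 mul1r scaleNr addNr.
Qed.

Lemma card_trivext : #|{: T}| = (#|S| * #|K| ^ n)%N.
Proof. by rewrite card_prod card_mx mul1n. Qed.

End TrivialExtension.

(** The kernel of f is the whole radical of R, so f factors through an
    isomorphism. *)
Lemma radical_map_quot_iso (R S : finNzRingType) (f : {rmorphism R -> S}) :
  radical_map f -> jacobson S = [set 0] -> ring_iso (quot_jacobson R) S.
Proof.
move=> f_rad JS.
have ker x : (x \in jacobson R) = (f x == 0).
  by rewrite (radical_map_jacobson _ f_rad) JS inE.
pose g (y : quot_jacobson R) : S := f (repr y).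
have gE x : g (to_quot x) = f x.
  by apply/eqP; rewrite -subr_eq0 -rmorphB -ker -pi_quot_eq; apply/eqP/reprK.
have gB : zmod_morphism g.
  move=> x y; have [[x' <-] [y' <-]] := (to_quot_surj x, to_quot_surj y).
  by rewrite -rmorphB !gE rmorphB.
have gM : monoid_morphism g.
  split=> [|x y]; first by rewrite -(rmorph1 (@to_quot R)) gE rmorph1.
  have [[x' <-] [y' <-]] := (to_quot_surj x, to_quot_surj y).
  by rewrite -rmorphM !gE rmorphM.
pose h1 := GRing.isZmodMorphism.Build _ _ g gB.
pose h2 := GRing.isMonoidMorphism.Build _ _ g gM.
pose h : {rmorphism quot_jacobson R -> S} := HB.pack g h1 h2.
have /fin_all_exists[k fk] := proj1 f_rad.
exists h; exists (fun y => to_quot (k y)) => y /=; last by rewrite gE fk.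
have [x <-] := to_quot_surj y; apply/eqP; rewrite -subr_eq0 -rmorphB to_quot_eq0.
by rewrite ker rmorphB fk gE subrr.
Qed.

Lemma field_jacobson (F : finFieldType) : jacobson F = [set 0].
Proof.
apply/setP=> x; rewrite inE; apply/idP/eqP=> [xJ | ->]; last exact: jacobson0.
apply/eqP/negPn/negP=> x0; have := jacobsonMl x^-1 xJ.
by rewrite mulVf //; apply/negP/jacobson1.
Qed.

Lemma field_pair_jacobson (F : finFieldType) : jacobson (F * F)%type = [set 0].
Proof.
apply/setP=> -[a b]; rewrite inE; apply/idP/eqP=> [xJ | ->]; last exact: jacobson0.
have abJ := jacobsonMl ((a^-1, b^-1) : F * F) xJ.
have idem (c : F) : c^-1 * c * (c^-1 * c) = c^-1 * c.
  by have [->|c0] := eqVneq c 0; rewrite ?mulr0 // mulVf ?mulr1.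
have ne0 (c : F) : c^-1 * c = 0 -> c = 0.
  move=> e; have [//|c0] := eqVneq c 0; move/eqP: e.
  by rewrite mulVf // oner_eq0.
have e : ((a^-1 * a, b^-1 * b) : F * F) = 0.
  by apply: jacobson_idempotent abJ _; rewrite !pair_mulE !idem.
by rewrite (ne0 a (congr1 fst e)) (ne0 b (congr1 snd e)).
Qed.

Lemma local_ring_idempotent (R : finNzRingType) (e : R) :
  local_ring R -> e * e = e -> e = 0 \/ e = 1.
Proof.
move=> /local_ringP loc ee; have [eJ | /loc einv] := boolP (e \in jacobson R).
  by left; apply: jacobson_idempotent.
right; apply/eqP; rewrite eq_sym -subr_eq0.
by apply/eqP/(invertible_lreg einv)/idem_mul_compl.
Qed.

Lemma local_ring_indecomposable (R : finNzRingType) : local_ring R -> indecomposable R.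
Proof.
by move=> loc; apply: central_indecomposable => e ee _; apply: local_ring_idempotent.
Qed.

Lemma field_local (F : finFieldType) : local_ring F.
Proof.
apply/local_ringP => x; rewrite field_jacobson inE => x0.
by apply: (@invertible_l _ _ x^-1); rewrite mulVf.
Qed.

Section LocalExample.
Variables (F : finFieldType) (n : nat).
Let R : finNzRingType := trivext n (idfun : {rmorphism F -> F}) idfun.
Let R_rad := trivext_radical_map (idfun : {rmorphism F -> F}) idfun n.

Lemma local_example :
  [/\ local_ring R, #|R| = (#|F| ^ n.+1)%N & #|jacobson R| = (#|F| ^ n)%N].
Proof.
have cardR : #|R| = (#|F| ^ n.+1)%N by rewrite card_trivext expnS.
have F_gt0 : (0 < #|F|)%N by apply/card_gt0P; exists 0.
split=> //.
  apply/local_ringP => x; rewrite (radical_map_jacobson _ R_rad) => xJ.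
  by apply: (proj2 R_rad); apply: (proj1 (local_ringP F) (field_local F)).
apply/eqP; rewrite -(eqn_pmul2r F_gt0) -expnSr -cardR.
rewrite (card_ker_surj (proj1 R_rad)).
rewrite eqn_pmul2r //; apply/eqP/eq_card => x.
by rewrite (radical_map_jacobson _ R_rad) field_jacobson !inE.
Qed.

End LocalExample.

Section TriangularExample.
Variables (F : finFieldType) (n : nat).
Let R : finNzRingType :=
  trivext n.+1 (fst : {rmorphism (F * F)%type -> F})
               (snd : {rmorphism (F * F)%type -> F}).

(** A central element commutes with the idempotent (1, 0) and with the bimodule, on
    which F x F acts differently from the two sides; hence it is a scalar. *)
Lemma triangular_example :
  [/\ indecomposable R, #|R| = (#|F| ^ n.+3)%N
    & ring_iso (quot_jacobson R) (F * F)%type].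
Proof.
split; last 2 first.
- by rewrite card_trivext card_prod -mulnA -!expnS.
- exact: radical_map_quot_iso (trivext_radical_map _ _ _) (field_pair_jacobson F).
apply: central_indecomposable => -[[a b] v] ee ec.
have v0 : v = 0.
  have := congr1 snd (ec ((1, 0), 0)); rewrite /= !scaler0 !scale0r !scale1r.
  by rewrite !addr0 => <-.
have ab : a = b.
  have := congr1 snd (ec ((0, 0), const_mx 1)); rewrite /= v0 !scaler0 addr0 add0r.
  by move=> /rowP/(_ 0); rewrite !mxE !mulr1.
have : a * a = a by have := congr1 (fun x : R => x.1.1) ee.
rewrite v0 -ab => /eqP; rewrite -subr_eq0 -{3}[a]mulr1 -mulrBr mulf_eq0 subr_eq0.
by case/orP=> /eqP->; [left | right].
Qed.

End TriangularExample.

Section MatrixExample.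
Variable F : finFieldType.
Let R : finNzRingType := 'M[F]_2.

(** Central matrices are scalar. *)
Lemma matrix_indecomposable : indecomposable R.
Proof.
apply: central_indecomposable => e ee ec.
have E (i j k l : 'I_2) : e k i * (l == j)%:R = (k == i)%:R * e j l.
  have /matrixP/(_ k l) := ec (delta_mx i j).
  rewrite [in LHS]mxE (bigD1 i) //= [X in _ + X]big1 => [|m mi]; last first.
    by rewrite mxE (negPf mi) mulr0.
  rewrite [in RHS]mxE [in RHS](bigD1 j) //= [X in _ = _ + X]big1 => [|m mj]; last first.
    by rewrite mxE (negPf mj) andbF mul0r.
  by rewrite !addr0 !mxE !eqxx andbT.
have eE : e = (e 0 0)%:M.
  apply/matrixP=> i j; rewrite mxE; have := E j 0 i 0.
  by rewrite eqxx mulr1 => ->; rewrite mulr_natl.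
move: (e 0 0) eE => a eE; have aa : a * a = a.
  have : (a * a)%:M = a%:M :> 'M[F]_2 by rewrite scalar_mxM -eE.
  by move=> /matrixP/(_ 0 0); rewrite !mxE.
move/eqP: aa; rewrite -subr_eq0 -{3}[a]mulr1 -mulrBr mulf_eq0 subr_eq0.
by rewrite eE; case/orP=> /eqP->; [left; rewrite raddf0 | right].
Qed.

(** If the nonzero matrix b has the inner inverse x, that is b x b = b, then the
    point R(w + x u), where (u, w) is a basis, is adjacent to R u but not to
    R(u + b w), because (b x, - b) is a relation between u + b w and w + x u. *)
Lemma matrix_twin_free : twin_free (distant_graph R).
Proof.
move=> P Q PQ; have [u uadm Pu] := pointP P; have [v vadm Qv] := pointP Q.
have /admissibleP[w uw] := uadm; have wu := basis_sym uw.
have adm x : admissible (w + x *: u) := basis_admissible (basis_shear x wu).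
have [a [b vE]] := basis_span uw v.
have near x : basis v (w + x *: u).
  have [X Xx] := mk_point (adm x); have := PQ X.
  rewrite /= (distantE uadm (adm x) Pu Xx) (distantE vadm (adm x) Qv Xx) => <-.
  exact/basis_sym/basis_shear.
have ainv : invertible a.
  have [s [t uE]] := basis_span (near 0) u.
  move: uE; rewrite vE scale0r addr0 scalerDr !scalerA -addrA -scalerDl => uE.
  have [] := basis_inj (a := 1) (b := 0) (c := s * a) (d := s * b + t) uw.
    by rewrite scale1r scale0r addr0.
  by move/esym/invertible_l.
have /invertibleP[c ac ca] := ainv.
have b0 : c * b = 0.
  pose x : R := pinvmx (c * b : 'M[F]_2).
  have bxb : c * b * x * (c * b) = c * b by apply: mulmxKpV.
  have /basisP ker := near x.
  have [|_ /eqP] := ker (c * b * x * c) (- (c * b)); last by rewrite oppr_eq0 => /eqP.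
  rewrite vE !scalerDr !scalerA -[_ * c * a]mulrA ca mulr1.
  by rewrite -[_ * c * b]mulrA bxb mulNr !scaleNr [X in _ + X]addrC -opprD subrr.
apply: val_inj; rewrite Pu Qv; apply/eqP; rewrite eq_sym; apply/left_cyclicP => //.
by exists a => //; rewrite vE -[b]mul1r -ac -mulrA b0 mulr0 scale0r addr0.
Qed.

(** Neither 0 nor invertible, E = E00 gives distinct points R u and R(u + E w)
    that are not adjacent. *)
Lemma matrix_not_complete : ~ complete_graph (distant_graph R).
Proof.
move=> compl; pose E : R := delta_mx 0 0.
have uw := basis_delta R; set u := delta_mx 0 0 in uw; set w := delta_mx 0 1 in uw.
have uadm := basis_admissible uw.
have vadm := basis_admissible (basis_shear E uw).
have [P Pu] := mk_point uadm; have [Q Qv] := mk_point vadm.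
have E0 : E <> 0 by move=> /matrixP/(_ 0 0)/eqP; rewrite !mxE oner_eq0.
have E1 : 1 - E <> 0 by move=> /matrixP/(_ 1 1)/eqP; rewrite !mxE subr0 oner_eq0.
have EE : E * E = E by apply: mul_delta_mx.
have PQ : P != Q.
  rewrite -(inj_eq val_inj) Pu Qv; apply/negP=> /(left_cyclicP _ uadm)[a _].
  rewrite scalerDr scalerA => e.
  have [] := basis_inj (a := 1) (b := 0) (c := a) (d := a * E) uw.
    by rewrite scale1r scale0r addr0.
  by move=> <-; rewrite mul1r => /esym.
move: PQ; rewrite -compl /= (distantE uadm vadm Pu Qv) => /basisP ker.
have [|//] := ker (- (1 - E)) (1 - E).
by rewrite scalerDr scalerA compl_mul_idem // scale0r addr0 -scalerDl addNr scale0r.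
Qed.

End MatrixExample.

(** * The five graphs *)

Lemma local_ring_graph (R : finNzRingType) (m q : nat) :
    (0 < m)%N -> local_ring R -> #|R| = (m * q)%N -> #|jacobson R| = m ->
  graph_iso (distant_graph R) (blowup (complete (q + 1)) m).
Proof.
move=> m_gt0 /local_ringP loc cardR cardJ; pose S : finNzRingType := quot_jacobson R.
have cardS : #|S| = q.
  by apply/eqP; rewrite -(eqn_pmul2l m_gt0) -cardR -{1}cardJ -card_quot_jacobson.
apply: graph_iso_trans (radical_map_iso (m := m) (to_quot_radical_map R) _) _.
  by rewrite cardR cardS.
rewrite -cardS; apply: blowup_iso; apply: division_iso => y.
have [x <-] := to_quot_surj y; rewrite to_quot_eq0 => /loc.
exact: rmorph_invertible.
Qed.

Lemma split_ring_graph (R : finNzRingType) (F : finFieldType) (m : nat) :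
    #|R| = (m * (#|F| * #|F|))%N -> ring_iso (quot_jacobson R) (F * F)%type ->
  graph_iso (distant_graph R)
    (blowup (tensor (complete (#|F| + 1)) (complete (#|F| + 1))) m).
Proof.
move=> cardR [f f_bij]; have [g fK gK] := f_bij.
pose h : {rmorphism R -> (F * F)%type} := f \o @to_quot R.
have h_rad : radical_map h.
  have [q_surj q_inv] := to_quot_radical_map R; split=> [y | x].
    by have [x xy] := q_surj (g y); exists x; rewrite /= xy gK.
  move=> /invertibleP[y xy _]; apply/q_inv/(@invertible_r _ _ (g y)).
  by apply: (can_inj fK); rewrite rmorphM rmorph1 gK.
apply: graph_iso_trans (radical_map_iso (m := m) h_rad _) _.
  by rewrite cardR card_prod.
apply: blowup_iso; apply: graph_iso_trans (product_iso F F) _.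
have F_iso : graph_iso (distant_graph F) (complete (#|F| + 1)).
  by apply: division_iso => x x0; apply: (@invertible_l _ _ x^-1); rewrite mulVf.
exact: tensor_iso.
Qed.

Lemma ring_iso_graph (R S : finNzRingType) :
  ring_iso R S -> graph_iso (distant_graph R) (distant_graph S).
Proof.
move=> [f [g fK gK]].
have f_rad : radical_map f.
  split=> [y | x /invertibleP[y xy _]]; first by exists (g y).
  by apply: (@invertible_r _ _ (g y)); apply: (can_inj fK); rewrite rmorphM rmorph1 gK.
apply: graph_iso_trans (radical_map_iso (m := 1) f_rad _) (blowup1 _).
by rewrite mul1n; apply: bij_eq_card; exists g.
Qed.

Definition five_graphs (p i : nat) : sgraph :=
  match i with
  | 1 => complete (p ^ 4 + 1)
  | 2 => blowup (complete (p ^ 2 + 1)) (p ^ 2)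
  | 3 => blowup (complete (p + 1)) (p ^ 3)
  | 4 => blowup (tensor (complete (p + 1)) (complete (p + 1))) (p ^ 2)
  | _ => distant_graph 'M['F_p]_2
  end.

Lemma card_five_graphs_lt (p i : nat) : prime p -> (1 <= i <= 3)%N ->
  (#|five_graphs p i| < #|five_graphs p i.+1|)%N.
Proof.
move=> p_prime; have p_gt1 := prime_gt1 p_prime; have p_gt0 := prime_gt0 p_prime.
case: i => [|[|[|[|]]]] //= _; rewrite !card_prod !card_ord.
- by rewrite mulnDl mul1n -expnD ltn_add2l -[1%N](exp1n 2) ltn_exp2r.
- by rewrite !mulnDl !mul1n -expnD -expnS ltn_add2l ltn_exp2l.
by rewrite -mulnA ltn_pmul2l ?addn1 // expnS ltn_pmul2r ?expn_gt0 ?p_gt0.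
Qed.

(** The first four graphs have different numbers of vertices. The last one is
    not complete, but unlike the blown-up graphs it is twin-free. *)
Lemma five_graphs_neq (p i j : nat) : prime p -> (1 <= i < j)%N -> (j <= 5)%N ->
  ~ graph_iso (five_graphs p i) (five_graphs p j).
Proof.
move=> p_prime /andP[i_gt0 ij] j5 iso; have p_gt1 := prime_gt1 p_prime.
case: (ltngtP j 5) j5 => // j5 _.
  suff lt : (#|five_graphs p i| < #|five_graphs p j|)%N.
    by rewrite (graph_iso_card iso) ltnn in lt.
  elim: j ij j5 {iso} => // j IHj; rewrite ltnS leq_eqVlt => /orP[/eqP <-|ij] j4.
    by apply: card_five_graphs_lt; rewrite ?i_gt0.
  apply: ltn_trans (IHj ij (ltnW j4)) (card_five_graphs_lt p_prime _).
  by rewrite (leq_trans i_gt0 (ltnW ij)).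
have pk_gt1 k : (0 < k)%N -> (1 < p ^ k)%N by move=> k0; rewrite -(exp1n k) ltn_exp2r.
have G5 : twin_free (five_graphs p 5) := @matrix_twin_free 'F_p.
rewrite {}j5 in ij iso; have iG := graph_iso_twin_free (graph_iso_sym iso) G5.
case: i i_gt0 ij iso iG => [|[|[|[|[|]]]]] //= _ _ iso iG.
- by apply: (@matrix_not_complete 'F_p); apply: graph_iso_complete iso _.
- by apply: (blowup_twins _ (pk_gt1 2%N isT) iG); rewrite card_ord addn1.
- by apply: (blowup_twins _ (pk_gt1 3%N isT) iG); rewrite card_ord addn1.
by apply: (blowup_twins _ (pk_gt1 2%N isT) iG); rewrite card_prod card_ord addn1.
Qed.

Theorem theorem6 (p : nat) (p_prime : prime p) :
  exists G : nat -> sgraph,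
    [/\ (* exactly five graphs up to isomorphism *)
        [/\ forall i j : nat, (1 <= i <= 5)%N -> (1 <= j <= 5)%N ->
              graph_iso (G i) (G j) -> i = j,
            forall i : nat, (1 <= i <= 5)%N ->
              exists R : finNzRingType,
                [/\ indecomposable R, #|R| = (p ^ 4)%N
                  & graph_iso (distant_graph R) (G i)]
          & forall R : finNzRingType, indecomposable R -> #|R| = (p ^ 4)%N ->
              exists2 i : nat, (1 <= i <= 5)%N
                & graph_iso (distant_graph R) (G i)],
        (* (1) *)
        complete_graph (G 1%N) /\ #|G 1%N| = (p ^ 4 + 1)%N,
        (* (2), (3) *)
        is_the_distant_graph (fun R : finNzRingType =>
            [/\ local_ring R, #|R| = (p ^ 4)%N
              & #|jacobson R| = (p ^ 2)%N]) (G 2%N) /\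
        is_the_distant_graph (fun R : finNzRingType =>
            [/\ local_ring R, #|R| = (p ^ 4)%N
              & #|jacobson R| = (p ^ 3)%N]) (G 3%N),
        (* (4) *)
        [/\ is_the_distant_graph (fun R : finNzRingType =>
              [/\ indecomposable R, #|R| = (p ^ 4)%N
                & ring_iso (quot_jacobson R) ('F_p * 'F_p)%type]) (G 4%N),
            union_of_disjoint_maximal_cliques (G 4%N) (p ^ 3 + p ^ 2)%N
          & clique_number (G 4%N) = (p + 1)%N]
        (* (5) *)
      & graph_iso (distant_graph 'M['F_p]_2) (G 5%N)].
Proof.
have p_gt0 := prime_gt0 p_prime.
have cardFp : #|'F_p| = p by apply: card_Fp.
have [F4 _ cardF4] := PrimePowerField p_prime (isT : 0 < 4)%N.
have [F2 _ cardF2] := PrimePowerField p_prime (isT : 0 < 2)%N.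
have ex2 : exists R : finNzRingType,
    [/\ local_ring R, #|R| = (p ^ 4)%N & #|jacobson R| = (p ^ 2)%N].
  have := local_example F2 1; set R := trivext _ _ _; rewrite cardF2 -expnM => ex.
  by exists R.
have ex3 : exists R : finNzRingType,
    [/\ local_ring R, #|R| = (p ^ 4)%N & #|jacobson R| = (p ^ 3)%N].
  have := local_example 'F_p 3; set R := trivext _ _ _; rewrite cardFp => ex.
  by exists R.
have ex4 : exists R : finNzRingType,
    [/\ indecomposable R, #|R| = (p ^ 4)%N
      & ring_iso (quot_jacobson R) ('F_p * 'F_p)%type].
  have := triangular_example 'F_p 1; set R := trivext _ _ _; rewrite cardFp => ex.
  by exists R.
have iso1 (R : finNzRingType) : (forall x : R, x != 0 -> invertible x) ->
    #|R| = (p ^ 4)%N -> graph_iso (distant_graph R) (five_graphs p 1).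
  by move=> R_inv cardR; rewrite /five_graphs -cardR; apply: division_iso.
have iso2 (R : finNzRingType) : local_ring R -> #|R| = (p ^ 4)%N ->
    #|jacobson R| = (p ^ 2)%N -> graph_iso (distant_graph R) (five_graphs p 2).
  by move=> loc cardR; apply: local_ring_graph; rewrite ?expn_gt0 ?p_gt0 // -expnD.
have iso3 (R : finNzRingType) : local_ring R -> #|R| = (p ^ 4)%N ->
    #|jacobson R| = (p ^ 3)%N -> graph_iso (distant_graph R) (five_graphs p 3).
  by move=> loc cardR; apply: local_ring_graph; rewrite ?expn_gt0 ?p_gt0 // -expnSr.
have iso4 (R : finNzRingType) : #|R| = (p ^ 4)%N ->
    ring_iso (quot_jacobson R) ('F_p * 'F_p)%type ->
    graph_iso (distant_graph R) (five_graphs p 4).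
  move=> cardR; have := @split_ring_graph R 'F_p (p ^ 2)%N.
  by rewrite cardFp mulnn -expnD => /(_ cardR).
exists (five_graphs p); split.
- split=> [i j i5 j5 ij | i | R indec cardR].
  + have [/andP[i1 i5'] /andP[j1 j5']] := (i5, j5).
    case: (ltngtP i j) => // lt; last first.
      by case: (@five_graphs_neq p j i); rewrite ?j1 //; apply: graph_iso_sym.
    by case: (@five_graphs_neq p i j); rewrite ?i1.
  + case: i => [|[|[|[|[|[|]]]]]] // _.
    * exists F4; split=> //; first exact/local_ring_indecomposable/field_local.
      by apply: iso1 => // x x0; apply: (@invertible_l _ _ x^-1); rewrite mulVf.
    * have [R [loc cardR cardJ]] := ex2.
      by exists R; split=> //; [apply: local_ring_indecomposable | apply: iso2].
    * have [R [loc cardR cardJ]] := ex3.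
      by exists R; split=> //; [apply: local_ring_indecomposable | apply: iso3].
    * have [R [indec cardR split_R]] := ex4.
      by exists R; split=> //; apply: iso4.
    * exists 'M['F_p]_2; split; first exact: (@matrix_indecomposable 'F_p).
        by rewrite card_mx cardFp.
      exact: graph_iso_refl.
  + case: (indecomposable_cases p_prime cardR indec).
    * by move=> R_inv; exists 1%N => //; apply: iso1.
    * by case=> loc cardJ; exists 2%N => //; apply: iso2.
    * by case=> loc cardJ; exists 3%N => //; apply: iso3.
    * case=> [split_R | mat_R]; first by exists 4%N => //; apply: iso4.
      by exists 5%N => //; apply/ring_iso_graph/ring_iso_sym.
- by split=> //; rewrite card_ord.
- by split; split=> // R []; [apply: iso2 | apply: iso3].
- have [m mE] : exists m, (p ^ 2 = m.+1)%N.
    by exists (p ^ 2).-1; rewrite prednK ?expn_gt0 ?p_gt0.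
  split.
  + by split=> // R [_]; apply: iso4.
  + have -> : (p ^ 3 + p ^ 2 = p.+1 * m.+1)%N by rewrite -mE mulSn addnC expnS.
    by rewrite /five_graphs mE addn1; apply: rook_diagonals.
  + by rewrite /five_graphs mE addn1; apply: rook_clique_number.
- exact: graph_iso_refl.
Qed.
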